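(* Let $f:\mathbb{C}\to\mathbb{C}$ be a transcendental entire function having a completely invariant domain $D$. If $f$ omits a point $a\in\mathbb{C}$ (that is, $f(z)\neq a$ for all $z\in\mathbb{C}$), then $a\in D$.
   Context: The Fatou set of an entire function $f$ is the set of points of $\mathbb{C}$ having a neighborhood on which the iterates $f^{n}$, $n\ge 1$, form a normal family. A completely invariant domain of $f$ is a connected component $D$ of the Fatou set of $f$ such that $f^{-1}(D)=D$. An entire function is transcendental if it is not a polynomial. *)

(* Defs.v *)
From mathcomp Require Import all_boot all_order all_algebra.
From mathcomp Require Import complex.
From mathcomp Require Import boolp classical_sets functions reals topology.
From mathcomp Require Import normedtype sequences derive.

Set Implicit Arguments.
Unset Strict Implicit.
Unset Printing Implicit Defensive.

Import Order.TTheory GRing.Theory Num.Theory.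
Import numFieldNormedType.Exports.

Local Open Scope classical_set_scope.
Local Open Scope ring_scope.
Local Open Scope complex_scope.

(* The complex plane is [R[i]^o]: the copy [^o] carries the topology of the
   modulus and the normed-module structure over [R[i]] itself, so that
   [derivable f z 1] is complex differentiability at [z]. *)

Definition entire (R : realType) (f : R[i]^o -> R[i]^o) : Prop :=
  forall z : R[i]^o, derivable f z 1.

Definition transcendental_entire (R : realType) (f : R[i]^o -> R[i]^o) : Prop :=
  entire f /\ ~ (exists p : {poly R[i]}, forall z : R[i], f z = p.[z]).

(* Uniform convergence of [u k] to the constant infinity on [K].  The modulus
   is compared with real bounds only, the order of [R[i]] being partial. *)
Definition uniformly_to_infinity (R : realType) (K : set R[i]^o)
    (u : nat -> R[i]^o -> R[i]^o) : Prop :=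
  forall M : R, \forall k \near \oo, forall z, K z -> M%:C < `|u k z|.

(* Normality in the sense of Montel: the constant infinity is an admissible
   limit.  [{uniform K, _ --> _}] is uniform convergence on [K]. *)
Definition normal_family (R : realType) (U : set R[i]^o)
    (F : set (R[i]^o -> R[i]^o)) : Prop :=
  forall u : nat -> R[i]^o -> R[i]^o, (forall k, F (u k)) ->
  exists2 phi : nat -> nat, {homo phi : i j / (i < j)%N} &
    (exists g : R[i]^o -> R[i]^o, forall K : set R[i]^o,
       compact K -> K `<=` U -> {uniform K, (u \o phi) @ \oo --> g}) \/
    (forall K : set R[i]^o,
       compact K -> K `<=` U -> uniformly_to_infinity K (u \o phi)).

Definition iterates (R : realType) (f : R[i]^o -> R[i]^o) :
    set (R[i]^o -> R[i]^o) :=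
  [set g | exists2 n, (1 <= n)%N & g = iter n f].

Definition fatou_set (R : realType) (f : R[i]^o -> R[i]^o) : set R[i]^o :=
  [set z | exists2 U, open_nbhs z U & normal_family U (iterates f)].

Definition fatou_component (R : realType) (f : R[i]^o -> R[i]^o)
    (D : set R[i]^o) : Prop :=
  exists2 z, fatou_set f z & D = connected_component (fatou_set f) z.

Definition completely_invariant_domain (R : realType) (f : R[i]^o -> R[i]^o)
    (D : set R[i]^o) : Prop :=
  fatou_component f D /\ f @^-1` D = D.

(* Main.v *)
Require Import Defs.
From mathcomp Require Import all_boot all_order all_algebra.
From mathcomp Require Import complex.
From mathcomp Require Import boolp classical_sets functions reals topology.
From mathcomp Require Import normedtype sequences derive.
From mathcomp Require Import ring lra.
From mathcomp Require Import constructive_ereal ereal measure lebesgue_measure.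
From mathcomp Require Import lebesgue_integral ftc realfun trigo exp.

(* Suppose [a] is not in [D].  As [f - a] has no zeros, [f - a = q ^ 2] with [q]
   entire; let [E] be the set of the [w] with [w ^ 2 + a] in [D].  Complete
   invariance gives [q @^-1` E = D], and [q] has dense image by Liouville, so
   [E] is connected.  Hence some compact connected [p] in [E] contains both [w]
   and [- w], and [K = p ^ 2 + a] is a compact connected subset of [D] on which
   [x - a] has no continuous square root: such a root at [v ^ 2 + a], divided
   by [v], would be a constant sign on [p], but it takes opposite values at [w]
   and [- w].  So [K] winds around [a].  The iterates of [f] omit [a], hence
   [f^n - a] obeys both the maximum and the minimum modulus principle, and
   normality extends from [K] to the region around which [K] winds.
   That region together with [K] is then a connected part of the Fatou set, so
   it lies in [D]; but it contains [a].

   The maximum principle comes from the mean value property, which is Goursat's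
   theorem for [f (z0 + exp z)] on rectangles of height [2 pi]. *)

Import Order.TTheory GRing.Theory Num.Theory.
Import numFieldNormedType.Exports.

Local Open Scope classical_set_scope.
Local Open Scope ring_scope.
Local Open Scope complex_scope.

Set Implicit Arguments.
Unset Strict Implicit.
Unset Printing Implicit Defensive.

(** The point [- w] comes from the symmetry of [E]: the map [w ^ 2 + a] is even. A path from [w] to
    [- w] makes an odd number of half turns around [0], and squaring doubles the angle, so its image
    winds an odd number of times around [a]. Only this parity matters, and continuous square roots
    detect it. This is why roots replace logarithms and contour integrals, and why compact connected
    sets can replace paths. Normality is local, so on [K] it has to be assembled from finitely many
    pieces. A subsequence could converge on one piece and tend to infinity on another; pieces that
    share a point exclude this. Both modulus principles are needed because the limit may be finite
    or infinite: the maximum principle carries smallness of differences from [K] to the region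
    inside, and the minimum principle carries largeness. *)

Local Notation modc := Normc.normc.
Local Notation Re := complex.Re.
Local Notation Im := complex.Im.

(** * The topology of the complex plane *)

Section Modulus.
Variable R : realType.
Implicit Types (x y z : R[i]) (r e : R).

Lemma normE z : `|z| = (modc z)%:C.
Proof. by []. Qed.

Lemma modc_ge0 z : 0 <= modc z.
Proof. by case: z => a b; apply: sqrtr_ge0. Qed.

Lemma modcD x y : modc (x + y) <= modc x + modc y.
Proof. exact: le_normcD. Qed.

Lemma modcB x y : modc (x - y) <= modc x + modc y.
Proof. by rewrite -(normcN y); exact: le_normcD. Qed.

Lemma modc_distrC x y : modc (x - y) = modc (y - x).
Proof. by rewrite -opprB normcN. Qed.

Lemma modc_real r : modc r%:C = `|r|.
Proof. by rewrite /= expr0n /= addr0 sqrtr_sqr. Qed.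

Lemma modc_eq0 z : (modc z == 0) = (z == 0).
Proof.
apply/eqP/eqP => [/Normc.eq0_normc //|->]; exact: Normc.normc0.
Qed.

Lemma modc_gt0 z : (0 < modc z) = (z != 0).
Proof. by rewrite lt_neqAle modc_ge0 andbT eq_sym modc_eq0. Qed.

Lemma modcX z n : modc (z ^+ n) = modc z ^+ n.
Proof.
elim: n => [|n IHn]; first exact: Normc.normc1.
by rewrite !exprS Normc.normcM IHn.
Qed.

Lemma modc_sqr z : modc z ^+ 2 = Re z ^+ 2 + Im z ^+ 2.
Proof. by case: z => a b /=; rewrite sqr_sqrtr // addr_ge0 ?sqr_ge0. Qed.

Lemma normr_Re_le z : `|Re z| <= modc z.
Proof.
rewrite -(ler_pXn2r (n:=2)) ?nnegrE ?modc_ge0 // modc_sqr -normrX ger0_norm ?sqr_ge0 //.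
by rewrite lerDl sqr_ge0.
Qed.

Lemma normr_Im_le z : `|Im z| <= modc z.
Proof.
rewrite -(ler_pXn2r (n:=2)) ?nnegrE ?modc_ge0 // modc_sqr -normrX ger0_norm ?sqr_ge0 //.
by rewrite lerDr sqr_ge0.
Qed.

Lemma modc_le_ReIm z : modc z <= `|Re z| + `|Im z|.
Proof.
rewrite -(ler_pXn2r (n:=2)) ?nnegrE ?modc_ge0 ?addr_ge0 // modc_sqr sqrrD.
by rewrite -!normrX !(ger0_norm (sqr_ge0 _)) // lerD2r lerDl mulrn_wge0 ?mulr_ge0.
Qed.

Lemma Re_add x y : Re (x + y) = Re x + Re y. Proof. by case: x y => a b []. Qed.
Lemma Im_add x y : Im (x + y) = Im x + Im y. Proof. by case: x y => a b []. Qed.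
Lemma Re_opp x : Re (- x) = - Re x. Proof. by case: x. Qed.
Lemma Im_opp x : Im (- x) = - Im x. Proof. by case: x. Qed.
Lemma Re_mul x y : Re (x * y) = Re x * Re y - Im x * Im y.
Proof. by case: x y => a b []. Qed.
Lemma Im_mul x y : Im (x * y) = Re x * Im y + Im x * Re y.
Proof. by case: x y => a b []. Qed.

Lemma Re_mulr r z : Re (r%:C * z) = r * Re z.
Proof. by rewrite Re_mul /= mul0r subr0. Qed.
Lemma Im_mulr r z : Im (r%:C * z) = r * Im z.
Proof. by rewrite Im_mul /= mul0r addr0. Qed.

Lemma modc_triangle y x z : modc (x - z) <= modc (x - y) + modc (y - z).
Proof.
by have -> : x - z = (x - y) + (y - z) by [rewrite addrA subrK]; exact: modcD.
Qed.

End Modulus.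

Section Topology.
Variable R : realType.
Local Notation C := (R[i]^o).
Implicit Types (x y z : C) (A K : set C).

Lemma ltc_real_gt0 (e : R[i]) : 0 < e -> exists2 r : R, 0 < r & e = r%:C.
Proof.
by case: e => a b; rewrite ltcE /= => /andP[/eqP -> a0]; exists a.
Qed.

(** The balls of [R[i]^o] have radii in [R[i]], whose order forces a positive radius to be real.
    This is the bridge to the estimates with the real-valued [modc] used below. *)
Lemma nbhs_modcP z A :
  nbhs z A <-> exists2 e : R, 0 < e & forall y, modc (y - z) < e -> A y.
Proof.
split.
- move/nbhs_ballP => [e /= e0 zA].
  have [r r0 er] := ltc_real_gt0 e0; exists r => // y yz.
  suff : ball z e y by exact: zA.
  by rewrite er -ball_normE /= normE ltcR modc_distrC.
- move=> [e e0 H]; apply/nbhs_ballP; exists e%:C => /=; first by rewrite ltcR.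
  move=> y; rewrite -ball_normE /= normE ltcR => yz; apply: H.
  by rewrite modc_distrC.
Qed.

Lemma cvg_modcP (T : Type) (F : set_system T) (FF : Filter F) (f : T -> C) z :
  f @ F --> z <-> forall e : R, 0 < e -> \forall t \near F, modc (f t - z) < e.
Proof.
split.
- move=> fz e e0; apply: (fz [set w : C | modc (w - z) < e]).
  by apply/nbhs_modcP; exists e.
- move=> H A /nbhs_modcP[e e0 eA]; rewrite /= nbhs_simpl.
  by apply: filterS (H _ e0) => t; apply: eA.
Qed.

Lemma continuous_modcP (f : C -> C) z : {for z, continuous f} <->
  forall e : R, 0 < e -> exists2 d : R, 0 < d &
    forall y, modc (y - z) < d -> modc (f y - f z) < e.
Proof.
have P := @cvg_modcP C (nbhs z) (nbhs_filter z) f (f z).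
rewrite /prop_for /continuous_at; split.
- move/P => H e e0; have /nbhs_modcP[d d0 dH] := H _ e0.
  by exists d.
- move=> H; apply/P => e e0; apply/nbhs_modcP.
  by have [d d0 dH] := H _ e0; exists d.
Qed.

Lemma continuous_real_modc (g : C -> R) :
  (forall y z, `|g y - g z| <= modc (y - z)) -> continuous g.
Proof.
move=> H z; apply/(@cvgrPdist_lt _ _ _ (nbhs z) (nbhs_filter z)) => e e0.
apply/nbhs_modcP; exists e => // y; rewrite distrC.
exact: le_lt_trans (H _ _).
Qed.

Lemma continuous_Re : continuous (@Re R : C -> R).
Proof. by apply: continuous_real_modc => y z; rewrite -Re_opp -Re_add normr_Re_le. Qed.

Lemma continuous_Im : continuous (@Im R : C -> R).
Proof. by apply: continuous_real_modc => y z; rewrite -Im_opp -Im_add normr_Im_le. Qed.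

Lemma modc_subr_le y z : `|modc y - modc z| <= modc (y - z).
Proof.
have H x w : modc x - modc w <= modc (x - w).
  by rewrite lerBlDr -{1}(subrK w x) modcD.
by rewrite ler_norml H andbT lerNl opprB modc_distrC H.
Qed.

Lemma continuous_modc : continuous (@modc R : C -> R).
Proof. by apply: continuous_real_modc => y z; exact: modc_subr_le. Qed.

Lemma continuous_complex (T : topologicalType) (u v : T -> R) :
  continuous u -> continuous v -> continuous (fun t => (u t +i* v t)%C : C).
Proof.
move=> cu cv t; apply/(@cvg_modcP _ (nbhs t) (nbhs_filter t)) => e e0.
have e2 : 0 < e / 2 by rewrite divr_gt0.
have /cvgrPdist_lt/(_ _ e2) Hu := cu t; have /cvgrPdist_lt/(_ _ e2) Hv := cv t.
near=> s.
apply: le_lt_trans (modc_le_ReIm _) _; rewrite !(Re_add, Re_opp, Im_add, Im_opp) /=.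
rewrite [e]splitr; apply: ltrD; rewrite distrC; near: s; [exact: Hu|exact: Hv].
Unshelve. all: by end_near. Qed.

(** Closed squares serve as compact connected neighbourhoods: their compactness is that of a product
    of two real segments. *)
Definition box z (r : R) : set C :=
  [set w | `|Re w - Re z| <= r /\ `|Im w - Im z| <= r].

Lemma box_compact z r : compact (box z r).
Proof.
pose I (c : R) := `[c - r, c + r]%classic.
have -> : box z r = (fun p : R * R => (p.1 +i* p.2)%C : C) @` (I (Re z) `*` I (Im z)).
  apply/seteqP; split => w.
  - move=> [wx wy]; exists (Re w, Im w); last by case: w wx wy.
    by split; rewrite /I /= in_itv /= -ler_distl.
  - case=> -[u v] [] /=; rewrite /I /= !in_itv /= -!ler_distl => ur vr <-.
    by split.
apply: continuous_compact; last by apply: compact_setX; exact: segment_compact.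
apply: continuous_subspaceT; apply: continuous_complex => p.
- exact: cvg_fst.
- exact: cvg_snd.
Qed.

Lemma modc_box z r w : modc (w - z) <= r -> box z r w.
Proof.
move=> H; split.
- by rewrite -Re_opp -Re_add (le_trans (normr_Re_le _)).
- by rewrite -Im_opp -Im_add (le_trans (normr_Im_le _)).
Qed.

Lemma box_modc z r w : box z r w -> modc (w - z) <= r + r.
Proof.
move=> [H1 H2]; apply: le_trans (modc_le_ReIm _) _.
by rewrite !(Re_add, Re_opp, Im_add, Im_opp) lerD.
Qed.

Lemma closed_bounded_compact K (r : R) :
  closed K -> (forall z, K z -> modc z <= r) -> compact K.
Proof.
move=> cK bK; apply: (subclosed_compact cK (@box_compact 0 r)) => z /bK zr.
by apply: modc_box; rewrite subr0.
Qed.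

Lemma compact_modc_bounded K : compact K ->
  exists2 r : R, 0 < r & forall z, K z -> modc z <= r.
Proof.
move=> cK; have [->|K0] := eqVneq K set0; first by exists 1.
have /set0P K1 := K0.
have cm : {within K, continuous (@modc R : C -> R)}.
  by apply: continuous_subspaceT; exact: continuous_modc.
have [c cK' Hc] := compact_EVT_max K1 cK cm.
exists (modc c + 1) => [|z /mem_set zK]; first by rewrite ltr_wpDl ?modc_ge0.
by apply: le_trans (Hc _ zK) _; rewrite lerDl.
Qed.

Lemma hausdorffC : hausdorff_space C.
Proof. exact: norm_hausdorff. Qed.

(** A star-shaped set is a union of segments through its centre. *)
Lemma connected_segments (z0 : C) (A : set C) : A z0 ->
  (forall z, A z -> forall t : R, 0 <= t <= 1 -> A (z0 + t%:C * (z - z0))) ->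
  connected A.
Proof.
move=> Az0 H.
pose S z := (fun t : R => z0 + t%:C * (z - z0) : C) @` `[0, 1]%classic.
have -> : A = \bigcup_(z in A) S z.
  apply/seteqP; split => w.
  - move=> Aw; exists w => //; exists 1; first by rewrite /= in_itv /= ler01 lexx.
    by rewrite /= mul1r addrC subrK.
  - by move=> [z Az [t]] /=; rewrite in_itv /= => t01 <-; exact: H.
apply: bigcup_connected.
- exists z0 => z Az; exists 0; first by rewrite /= in_itv /= ler01 lexx.
  by rewrite /= mul0r addr0.
- move=> z Az; apply: connected_continuous_connected.
    exact: segment_connected.
  apply: continuous_subspaceT => t; apply: cvgD; first exact: cvg_cst.
  apply: cvgM; last exact: cvg_cst.
  by apply: (@continuous_complex R id (fun=> 0)) => s; [exact: cvg_id|exact: cvg_cst].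
Qed.

Lemma connected_box z r : 0 <= r -> connected (box z r).
Proof.
move=> r0; apply: (@connected_segments z).
  by split; rewrite subrr normr0.
move=> w [H1 H2] t /andP[t0 t1]; split.
- rewrite Re_add Re_mul /= mul0r subr0 addrC addKr normrM ger0_norm //.
  by rewrite Re_add Re_opp -[r]mul1r ler_pM.
- rewrite Im_add Im_mul /= mul0r addr0 addrC addKr normrM ger0_norm //.
  by rewrite Im_add Im_opp -[r]mul1r ler_pM.
Qed.

Lemma connectedC : connected [set: C].
Proof. exact: (@connected_segments 0). Qed.

Lemma connected_ball_modc z r : 0 < r -> connected [set w : C | modc (w - z) < r].
Proof.
move=> r0; apply: (@connected_segments z); first by rewrite /= subrr Normc.normc0.
move=> w /= wr t /andP[t0 t1].
rewrite addrC addKr Normc.normcM modc_real ger0_norm //.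
by apply: le_lt_trans wr; rewrite ler_piMl ?modc_ge0.
Qed.

(** The real part of [h] maps [p] onto an interval, which would contain [0] if both signs
    occurred. *)
Lemma connected_sign_cst (p : set C) (h : C -> C) : connected p ->
  {within p, continuous h} -> (forall x, p x -> h x = 1 \/ h x = -1) ->
  forall x y, p x -> p y -> h x = h y.
Proof.
move=> cp ch h1 x y px py.
have /connected_intervalP I : connected ((@Re R : C -> R) @` (h @` p)).
  apply: connected_continuous_connected; last first.
    by apply: continuous_subspaceT; exact: continuous_Re.
  exact: connected_continuous_connected.
have E w : p w -> ((@Re R : C -> R) @` (h @` p)) (Re (h w)).
  by move=> pw; exists (h w) => //; exists w.
have no0 : ~ ((@Re R : C -> R) @` (h @` p)) 0.
  move=> [_ [w pw <-]]; have [->|->] := h1 _ pw => /= /eqP.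
    by rewrite oner_eq0.
  by rewrite oppr_eq0 oner_eq0.
have := E _ px; have := E _ py.
have [->|->] := h1 _ px; have [->|->] := h1 _ py => //= E1 E2; case: no0.
- by apply: (I _ _ E1 E2); rewrite oppr_le0 ler01.
- by apply: (I _ _ E2 E1); rewrite oppr_le0 ler01.
Qed.

End Topology.

(** * Complex differentiability and entire functions *)

Section Entire.
Variable R : realType.
Local Notation C := (R[i]^o).
Implicit Types (f g h : C -> C) (z : C).

(** The difference quotient is cleared of its denominator, so that the estimate also covers the
    increment [0]. *)
Lemma derivable_modcP f z : derivable f z 1 <->
  exists c : C, forall e : R, 0 < e -> exists2 d : R, 0 < d &
    forall k : C, modc k < d -> modc (f (z + k) - f z - c * k) <= e * modc k.
Proof.
have FF : Filter (0 : C)^' by exact: dnbhs_filter.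
split.
- move=> /cvg_ex[/= c /(@cvg_modcP _ _ _ FF) H]; exists c => e e0.
  have /nbhs_modcP[d d0 dH] := H _ e0; exists d => // k kd.
  have [->|k0] := eqVneq k 0.
    by rewrite addr0 subrr mulr0 subr0 Normc.normc0 mulr0.
  have := dH k; rewrite subr0 => /(_ kd k0) /ltW.
  rewrite -(ler_pM2r (x := modc k)) ?modc_gt0 // -Normc.normcM; congr (modc _ <= _).
  rewrite mulrBl /GRing.scale /= mulr1 (addrC k) mulrAC mulVf // mul1r.
  by rewrite mulrC.
- move=> [c H]; apply/cvg_ex; exists c => /=; apply/(@cvg_modcP _ _ _ FF) => e e0.
  have e2 : 0 < e / 2 by rewrite divr_gt0.
  have [d d0 dH] := H _ e2; apply/nbhs_modcP; exists d => // k; rewrite subr0 => kd k0.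
  apply: (@le_lt_trans _ _ (e / 2)); last by rewrite ltr_pdivrMr // ltr_pMr // ltr1n.
  rewrite -(ler_pM2r (x := modc k)) ?modc_gt0 // -Normc.normcM.
  apply: le_trans (dH _ kd); rewrite le_eqVlt; apply/orP; left; apply/eqP.
  congr (modc _); rewrite mulrBl /GRing.scale /= mulr1 (addrC k) mulrAC mulVf // mul1r.
  by [].
Qed.

Lemma entire_differentiable f : entire f <-> forall z, differentiable f z.
Proof. by split=> H z; apply/derivable1_diffP. Qed.

Lemma entire_continuous f : entire f -> continuous f.
Proof. by move=> /entire_differentiable H z; exact: differentiable_continuous. Qed.

Lemma entire_cst (c : C) : entire (fun=> c).
Proof. by move=> z; exact: derivable_cst. Qed.

Lemma entire_id : entire (id : C -> C).
Proof. by move=> z; exact: derivable_id. Qed.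

Lemma entireD f g : entire f -> entire g -> entire (fun z => f z + g z).
Proof. by move=> Hf Hg z; exact: derivableD. Qed.

Lemma entireB f g : entire f -> entire g -> entire (fun z => f z - g z).
Proof. by move=> Hf Hg z; exact: derivableB. Qed.

Lemma entireM f g : entire f -> entire g -> entire (fun z => f z * g z).
Proof. by move=> Hf Hg z; exact: derivableM. Qed.

Lemma entire_sqr f : entire f -> entire (fun z => f z ^+ 2).
Proof. by move=> Hf; exact: (entireM Hf Hf). Qed.

Lemma entire_comp f g : entire f -> entire g -> entire (f \o g).
Proof.
move=> /entire_differentiable Hf /entire_differentiable Hg.
by apply/entire_differentiable => z; exact: differentiable_comp.
Qed.

Lemma entireV f : entire f -> (forall z, f z != 0) -> entire (fun z => (f z)^-1).
Proof.
move=> /entire_differentiable Hf f0.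
by apply/entire_differentiable => z; exact: differentiableV.
Qed.

Lemma entire_iter f n : entire f -> entire (iter n f).
Proof.
move=> Hf; elim: n => [|n IHn]; first exact: entire_id.
exact: (entire_comp Hf IHn).
Qed.

End Entire.

(** * Goursat's theorem and the maximum principle *)

Section RealLine.
Variable R : realType.
Local Notation C := (R[i]^o).
Implicit Types (g phi : R -> R) (G E : R -> C).

Lemma is_derive_normrP g x d : is_derive x (1 : R) g d <->
  forall e : R, 0 < e -> exists2 r : R, 0 < r &
    forall k : R, `|k| < r -> `|g (x + k) - g x - k * d| <= e * `|k|.
Proof.
split.
- move=> gd e e0.
  have [dg gE] := gd; move: dg => /cvg_ex[/= c gc].
  have cd : c = d by rewrite -gE /derive; symmetry; apply: cvg_lim gc.
  move: gc; rewrite cd => /cvgrPdist_lt/(_ _ e0) /nbhs_ballP[r /= r0 rH].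
  exists r => // k kr; have [->|k0] := eqVneq k 0.
    by rewrite addr0 subrr mul0r subr0 normr0 mulr0.
  have : ball 0 r k by rewrite -ball_normE /= sub0r normrN.
  move=> /rH /(_ k0) /ltW.
  rewrite -(ler_pM2r (x := `|k|)) ?normr_gt0 // -normrM; congr (_ <= _).
  rewrite mulrBl /GRing.scale /= mulr1 (addrC k) mulrAC mulVf // mul1r.
  by rewrite distrC (mulrC d).
- move=> H.
  have L : (fun h : R => h^-1 *: (g (h *: (1 : R^o) + x) - g x)) @ 0^' --> d.
    apply/cvgrPdist_lt => e e0; have e2 : 0 < e / 2 by rewrite divr_gt0.
    have [r r0 rH] := H _ e2; apply/nbhs_ballP; exists r => // k.
    rewrite -ball_normE /= sub0r normrN => kr k0.
    apply: (@le_lt_trans _ _ (e / 2)); last by rewrite ltr_pdivrMr // ltr_pMr // ltr1n.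
    rewrite -(ler_pM2r (x := `|k|)) ?normr_gt0 // -normrM.
    apply: le_trans (rH _ kr); rewrite le_eqVlt; apply/orP; left; apply/eqP.
    rewrite mulrBl /GRing.scale /= mulr1 (addrC k) mulrAC mulVf // mul1r.
    by rewrite distrC (mulrC d).
  by split; [apply/cvg_ex; exists d | exact: cvg_lim L].
Qed.

Lemma exists_primitive_itv phi (n : R) : 0 < n -> continuous phi ->
  exists P : R -> R, forall x, `|x| < n -> is_derive x (1 : R) P (phi x).
Proof.
move=> n0 cphi.
have I : (@lebesgue_measure R).-integrable `[- n, n] (EFin \o phi).
  apply: continuous_compact_integrable; first exact: segment_compact.
  exact: continuous_subspaceT.
exists (fun x => (\int[@lebesgue_measure R]_(t in [set` `[(- n), x]]) (phi t))%R) => x.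
rewrite ltr_norml => /andP[nx xn].
have [dP PE] := @continuous_FTC1_closed R phi (- n) x n xn I nx (cphi x).
by split; [exact: dP | rewrite -derive1E; exact: PE].
Qed.

(** Primitives on two intervals centred at [0] differ by a constant on the smaller one. Once their
    values at [0] are subtracted they agree, and glue to a primitive on the line. *)
Lemma exists_primitive phi : continuous phi ->
  exists P : R -> R, forall x, is_derive x (1 : R) P (phi x).
Proof.
move=> cphi.
have /choice[P HP] : forall n : nat, exists P : R -> R,
    forall x, `|x| < n.+1%:R -> is_derive x (1 : R) P (phi x).
  by move=> n; apply: exists_primitive_itv.
have E m n x : `|x| < m.+1%:R -> `|x| < n.+1%:R -> P m x - P m 0 = P n x - P n 0.
  move=> xm xn.
  have D y : `|y| <= `|x| -> is_derive y (1 : R) (P m \- P n) 0.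
    move=> yx; rewrite -(subrr (phi y)); apply: is_deriveB; apply: HP.
    - exact: le_lt_trans xm.
    - exact: le_lt_trans xn.
  have cD a b : `|a| <= `|x| -> `|b| <= `|x| ->
      {within `[a, b], continuous (P m \- P n)}.
    move=> ax bx; apply: derivable_within_continuous => y.
    rewrite in_itv /= => /andP[ay yb].
    suff /D[] : `|y| <= `|x| by [].
    by move: ax bx; rewrite !ler_norml => /andP[? ?] /andP[? ?]; lra.
  have K a b : a <= b -> `|a| <= `|x| -> `|b| <= `|x| -> 
      (P m \- P n) b - (P m \- P n) a = 0.
    move=> ab ax bx.
    have [|c _ ->] := MVT_segment (df := fun=> 0) ab _ (cD _ _ ax bx).
      move=> y; rewrite in_itv /= => /andP[ay yb]; apply: D.
      by move: ax bx; rewrite !ler_norml => /andP[? ?] /andP[? ?]; lra.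
    by rewrite mul0r.
  case: (leP 0 x) => x0.
  - have := K _ _ x0; rewrite normr0 normr_ge0 lexx /= => /(_ isT isT); lra.
  - have := K _ _ (ltW x0); rewrite normr0 normr_ge0 lexx /= => /(_ isT isT); lra.
pose N (x : R) := Num.truncn `|x|.
have HN x : `|x| < (N x).+1%:R by rewrite /N truncnS_gt.
exists (fun x => P (N x) x - P (N x) 0) => x.
apply/is_derive_normrP => e e0.
have /is_derive_normrP/(_ _ e0)[r r0 rH] := HP _ _ (HN x).
(* The second bound keeps [x + k] in the interval chosen for [x], where [E] allows the same
   primitive to be used for both points. *)
exists (Num.min r ((N x).+1%:R - `|x|)); first by rewrite lt_min r0 subr_gt0 HN.
move=> k; rewrite lt_min => /andP[kr kx].
rewrite (E (N (x + k)) (N x)) //; last first.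
  by apply: le_lt_trans (ler_normD _ _) _; rewrite addrC -ltrBrDr.
have -> : P (N x) (x + k) - P (N x) 0 - (P (N x) x - P (N x) 0) =
  P (N x) (x + k) - P (N x) x by ring.
exact: rH.
Qed.

(** The variable is real while [R[i]^o] is a normed module over [R[i]], so the derivative of a curve
    is spelled out as a first-order estimate. *)
Definition has_deriv G x (d : C) := forall e : R, 0 < e ->
  exists2 r : R, 0 < r &
    forall k : R, `|k| < r -> modc (G (x + k) - G x - k%:C * d) <= e * `|k|.

Lemma has_derivB G1 G2 x d1 d2 : has_deriv G1 x d1 -> has_deriv G2 x d2 ->
  has_deriv (fun t => G1 t - G2 t) x (d1 - d2).
Proof.
move=> H1 H2 e e0; have e2 : 0 < e / 2 by rewrite divr_gt0.
have [r1 r10 {}H1] := H1 _ e2; have [r2 r20 {}H2] := H2 _ e2.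
exists (Num.min r1 r2); first by rewrite lt_min r10.
move=> k; rewrite lt_min => /andP[k1 k2].
rewrite [X in modc X](_ : _ = (G1 (x + k) - G1 x - k%:C * d1) -
    (G2 (x + k) - G2 x - k%:C * d2)); last by ring.
apply: le_trans (modcB _ _) _; rewrite [e]splitr mulrDl.
by apply: lerD; [exact: H1 | exact: H2].
Qed.

Lemma has_derivZ (c : C) G x d : has_deriv G x d ->
  has_deriv (fun t => c * G t) x (c * d).
Proof.
move=> H e e0; have c1 : 0 < modc c + 1 by rewrite ltr_wpDl ?modc_ge0.
have [|r r0 {}H] := H (e / (modc c + 1)); first by rewrite divr_gt0.
exists r => // k kr.
rewrite [X in modc X](_ : _ = c * (G (x + k) - G x - k%:C * d)); last by ring.
rewrite Normc.normcM.
apply: (@le_trans _ _ ((modc c + 1) * (e / (modc c + 1) * `|k|))).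
  apply: ler_pM; rewrite ?modc_ge0 //; first by rewrite lerDl.
  exact: H.
by rewrite mulrA (mulrC (modc c + 1)) divfK ?gt_eqF.
Qed.

Lemma has_deriv_Re G x d : has_deriv G x d ->
  is_derive x (1 : R) (fun t => Re (G t) : R) (Re d).
Proof.
move=> H; apply/is_derive_normrP => e e0; have [r r0 {}H] := H _ e0.
exists r => // k kr; apply: le_trans (H _ kr); apply: le_trans (normr_Re_le _).
by rewrite !(Re_add, Re_opp, Re_mulr).
Qed.

Lemma has_deriv_ReIm (u v : R -> R) x a b : is_derive x (1 : R) u a -> is_derive x (1 : R) v b ->
  has_deriv (fun t => (u t +i* v t)%C) x (a +i* b)%C.
Proof.
move=> /is_derive_normrP Hu /is_derive_normrP Hv e e0.
have e2 : 0 < e / 2 by rewrite divr_gt0.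
have [r1 r10 {}Hu] := Hu _ e2; have [r2 r20 {}Hv] := Hv _ e2.
exists (Num.min r1 r2); first by rewrite lt_min r10.
move=> k; rewrite lt_min => /andP[k1 k2].
apply: le_trans (modc_le_ReIm _) _.
rewrite !(Re_add, Re_opp, Re_mulr, Im_add, Im_opp, Im_mulr) [e]splitr mulrDl.
by apply: lerD; [exact: Hu | exact: Hv].
Qed.

Lemma exists_cprimitive (phi : R -> C) : continuous phi ->
  exists P : R -> C, forall x, has_deriv P x (phi x).
Proof.
move=> cphi.
have [|u Hu] := @exists_primitive (fun t => Re (phi t)).
  by move=> t; apply: continuous_comp; [exact: cphi | exact: continuous_Re].
have [|v Hv] := @exists_primitive (fun t => Im (phi t)).
  by move=> t; apply: continuous_comp; [exact: cphi | exact: continuous_Im].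
exists (fun t => (u t +i* v t)%C) => x.
rewrite (_ : phi x = (Re (phi x) +i* Im (phi x))%C); last by case: (phi x).
exact: has_deriv_ReIm.
Qed.

(** The mean value theorem holds for real values only. It is applied to the component of [G] in the
    direction of the total increment [w]: the increment of [Re (conjc w * G t)] is the square of
    [modc w]. *)
Lemma has_deriv_modc_le G E a b m : a <= b ->
  (forall x, has_deriv G x (E x)) ->
  (forall x, a <= x <= b -> modc (E x) <= m) ->
  modc (G b - G a) <= m * (b - a).
Proof.
move=> ab dG Em; set w := (G b - G a).
pose g t := Re (conjc w * G t).
have dg x : is_derive x (1 : R) g (Re (conjc w * E x)).
  exact: has_deriv_Re (has_derivZ (conjc w) (dG x)).
have [|c cab Ec] := MVT_segment (f := g) (df := fun x => Re (conjc w * E x)) ab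
    (fun x _ => dg x).
  by apply: derivable_within_continuous => x _; have [] := dg x.
have [->|w0] := eqVneq (modc w) 0.
  apply: mulr_ge0; last by rewrite subr_ge0.
  by apply: le_trans (Em a _); rewrite ?modc_ge0 ?lexx.
have wp : 0 < modc w by rewrite lt_neqAle eq_sym w0 modc_ge0.
have wc : modc (conjc w) = modc w.
  by case: (w) => p q /=; rewrite sqrrN.
rewrite -(ler_pM2l wp).
have -> : modc w * modc w = g b - g a.
  rewrite -expr2 modc_sqr /g /w !(Re_mul, Re_add, Re_opp, Im_add, Im_opp).
  case: (G b) (G a) => p q [p' q'] /=; ring.
rewrite Ec mulrA; apply: ler_wpM2r; first by rewrite subr_ge0.
apply: le_trans (ler_norm _) _; apply: le_trans (normr_Re_le _) _.
rewrite Normc.normcM wc ler_pM2l //; apply: Em.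
by move: cab; rewrite in_itv.
Qed.

Lemma has_deriv_uniq G1 G2 (E : R -> C) a b :
  (forall x, has_deriv G1 x (E x)) -> (forall x, has_deriv G2 x (E x)) ->
  G1 b - G1 a = G2 b - G2 a.
Proof.
move=> H1 H2.
wlog ab : a b / a <= b.
  move=> W; case: (leP a b) => [|/ltW]; first exact: W.
  by move=> /W K; rewrite -opprB K opprB.
have H x : has_deriv (fun t => G1 t - G2 t) x 0.
  by rewrite -(subrr (E x)); exact: has_derivB.
have := has_deriv_modc_le (m := 0) ab H; rewrite mul0r Normc.normc0.
move=> /(_ (fun _ _ => lexx _)) L.
apply/eqP; rewrite -subr_eq0 -modc_eq0 eq_le modc_ge0 andbT.
apply: le_trans L; rewrite le_eqVlt; apply/orP; left; apply/eqP; congr modc.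
ring.
Qed.

End RealLine.

(** The supremum of the left ends lies below every right end. The length [0] is allowed because a
    rectangle below may have a degenerate side. *)
Lemma nested_halving (R : realType) (x : nat -> R) (l : R) : 0 <= l ->
  (forall n, x n <= x n.+1 /\ x n.+1 + l / 2 ^+ n.+1 <= x n + l / 2 ^+ n) ->
  exists y, forall n, x n <= y <= x n + l / 2 ^+ n.
Proof.
move=> l0 Hx.
have ln n : 0 <= l / 2 ^+ n by rewrite divr_ge0 // exprn_ge0.
have up n k : x n <= x (k + n)%N.
  by elim: k => [//|k IH]; apply: le_trans IH _; have [] := Hx (k + n)%N.
have dn n k : x (k + n)%N + l / 2 ^+ (k + n)%N <= x n + l / 2 ^+ n.
  by elim: k => [//|k IH]; apply: le_trans IH; have [] := Hx (k + n)%N.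
have ub m n : x m <= x n + l / 2 ^+ n.
  case: (leqP m n) => mn.
  - rewrite -(subnK mn); apply: le_trans (up m (n - m)%N) _.
    by rewrite lerDl.
  - rewrite -(subnK (ltnW mn)); apply: le_trans (dn n (m - n)%N).
    by rewrite lerDl.
exists (sup (range x)) => n; apply/andP; split.
- apply: ub_le_sup; last by exists n.
  by exists (x 0%N + l / 2 ^+ 0) => _ [m _ <-].
- apply: ge_sup; first by exists (x 0%N); exists 0%N.
  by move=> _ [m _ <-].
Qed.

Lemma halving_lt (R : realType) (p d : R) : 0 < d -> exists n : nat, p / 2 ^+ n < d.
Proof.
move=> d0; have := truncnS_gt `|p / d|.
set n := (Num.truncn `|p / d|).+1 => H1; exists n.
have H2 : n%:R <= 2 ^+ n :> R by rewrite -natrX ler_nat ltnW // ltn_expl.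
have P : 0 < 2 ^+ n :> R by rewrite exprn_gt0.
rewrite ltr_pdivrMr // mulrC -ltr_pdivrMr //.
by apply: le_lt_trans (ler_norm _) _; exact: lt_le_trans H2.
Qed.

(** * Goursat's theorem for rectangles *)

Section Goursat.
Variable R : realType.
Local Notation C := (R[i]^o).
(* [H] and [V] are primitives of [F] along horizontal and vertical lines. *)
Variables (F : C -> C) (H V : R -> R -> C).
Hypothesis F_entire : entire F.
Hypothesis derivH : forall s t, has_deriv (fun x => H x t) s (F (s +i* t)%C).
Hypothesis derivV : forall s t, has_deriv (fun y => V s y) t (F (s +i* t)%C).

(** The integral of [F] counterclockwise along the boundary of the rectangle with lower left corner
    [s +i* t]: bottom, right, top, left. Each side is the increment of a primitive, and [dz] is
    ['i dy] on the vertical ones. *)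
Definition rect_integral s t l1 l2 : C :=
  (H (s + l1) t - H s t) + 'i%C * (V (s + l1) (t + l2) - V (s + l1) t)
  - (H (s + l1) (t + l2) - H s (t + l2)) - 'i%C * (V s (t + l2) - V s t).

(** The inner sides of the four quarters are run through twice, in opposite directions. *)
Lemma rect_integral_split s t l1 l2 :
  rect_integral s t (l1 + l1) (l2 + l2) =
  rect_integral s t l1 l2 + rect_integral (s + l1) t l1 l2 +
  rect_integral s (t + l2) l1 l2 + rect_integral (s + l1) (t + l2) l1 l2.
Proof. by rewrite /rect_integral !addrA; ring. Qed.

(* Replacing [F] by its affine part at [z], which has an entire primitive,
   costs an error quadratic in the perimeter. *)
Lemma rect_integral_local (z c : C) (e d : R) s t l1 l2 : 0 < e ->
  (forall k, modc k < d -> modc (F (z + k) - F z - c * k) <= e * modc k) ->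
  s <= Re z <= s + l1 -> t <= Im z <= t + l2 -> l1 + l2 < d ->
  modc (rect_integral s t l1 l2) <= (e + e) * (l1 + l2) ^+ 2.
Proof.
move=> e0 Hz /andP[s1 s2] /andP[t1 t2] ld.
have l10 : 0 <= l1 by lra.
have l20 : 0 <= l2 by lra.
pose a (w : C) : C := F z + c * (w - z).
pose A (w : C) : C := F z * w + c * (w - z) ^+ 2 / 2%:R.
have two0 : (2%:R : C) != 0 by rewrite pnatr_eq0.
have AE w k : A (w + k) - A w - k * a w = c * k ^+ 2 / 2%:R.
  by rewrite /A /a; field.
have Ad w (k : C) : modc (A (w + k) - A w - k * a w) <= modc c * modc k ^+ 2.
  rewrite AE 2!Normc.normcM modcX Normc.normcV ler_piMr ?mulr_ge0 ?sqr_ge0 ?modc_ge0 //.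
  rewrite (_ : modc 2%:R = 2); last by rewrite -[2%:R](rmorph_nat (real_complex R)) modc_real normr_nat.
  by rewrite invf_le1 // ler1n.
have dA (u : R -> C) (v : C) x : (forall k : R, u (x + k) = u x + k%:C * v) ->
    modc v = 1 -> has_deriv (fun x => A (u x)) x (v * a (u x)).
  move=> Hu v1 e1 e10; exists (e1 / (modc c + 1)).
    by rewrite divr_gt0 // ltr_wpDl ?modc_ge0.
  move=> k; rewrite ltr_pdivlMr ?ltr_wpDl ?modc_ge0 // => kr.
  rewrite Hu mulrA; apply: le_trans (Ad _ _) _.
  rewrite Normc.normcM v1 modc_real mulr1 expr2 mulrA; apply: ler_wpM2r => //.
  apply: ltW; apply: le_lt_trans kr; rewrite mulrC; apply: ler_wpM2l => //.
  by rewrite lerDl.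
have i1 : modc ('i%C : C) = 1 by rewrite /= expr0n expr1n add0r sqrtr1.
have dAh t' s' : has_deriv (fun x => A (x +i* t')%C) s' (a (s' +i* t')%C).
  rewrite -[a _]mul1r; apply: (dA (fun x => (x +i* t')%C)); last exact: Normc.normc1.
  by move=> k; apply/eqP; rewrite mulr1 eq_complex /= addr0 !eqxx.
have dAv s' t' : has_deriv (fun y => A (s' +i* y)%C) t' ('i%C * a (s' +i* t')%C).
  apply: (dA (fun y => (s' +i* y)%C)) => // k.
  by apply/eqP; rewrite eq_complex /= !mulr0 !mul0r mulr1 subrr addr0 addr0 !eqxx.
have Ebound x y : s <= x <= s + l1 -> t <= y <= t + l2 ->
    modc (F (x +i* y)%C - a (x +i* y)%C) <= e * (l1 + l2).
  move=> /andP[x1 x2] /andP[y1 y2].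
  have kb : modc ((x +i* y)%C - z) <= l1 + l2.
    apply: le_trans (modc_le_ReIm _) _; rewrite !(Re_add, Im_add, Re_opp, Im_opp) /=.
    by apply: lerD; rewrite ler_norml; apply/andP; split; lra.
  have := Hz _ (le_lt_trans kb ld); rewrite (addrC z) subrK => K.
  rewrite /a opprD addrA; apply: le_trans K _.
  by rewrite ler_wpM2l // ltW.
have edgeH t' : t <= t' <= t + l2 ->
    modc ((H (s + l1) t' - A ((s + l1) +i* t')%C) - (H s t' - A (s +i* t')%C))
      <= e * (l1 + l2) * l1.
  move=> ht; have -> : e * (l1 + l2) * l1 = e * (l1 + l2) * (s + l1 - s) by ring.
  apply: (has_deriv_modc_le (G := fun x => H x t' - A (x +i* t')%C)
     (E := fun x => F (x +i* t')%C - a (x +i* t')%C)); first by rewrite lerDl.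
  - by move=> x; apply: has_derivB.
  - by move=> x hx; exact: Ebound.
have edgeV s' : s <= s' <= s + l1 ->
    modc (('i%C * V s' (t + l2) - A (s' +i* (t + l2))%C) -
      ('i%C * V s' t - A (s' +i* t)%C)) <= e * (l1 + l2) * l2.
  move=> hs; have -> : e * (l1 + l2) * l2 = e * (l1 + l2) * (t + l2 - t) by ring.
  apply: (has_deriv_modc_le (G := fun y => 'i%C * V s' y - A (s' +i* y)%C)
     (E := fun y => 'i%C * F (s' +i* y)%C - 'i%C * a (s' +i* y)%C)); first by rewrite lerDl.
  - by move=> y; apply: has_derivB => //; exact: has_derivZ.
  - by move=> y hy; rewrite -mulrBr Normc.normcM i1 mul1r; exact: Ebound.
have h1 := edgeH t; have h2 := edgeH (t + l2).
have v1 := edgeV s; have v2 := edgeV (s + l1).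
(* The values of [A] at the four corners cancel around the boundary, so subtracting [A] on each side
   leaves the integral unchanged. The four sides then add up to twice
   [e * (l1 + l2) * (l1 + l2)]. *)
rewrite (_ : rect_integral s t l1 l2 =
  ((H (s + l1) t - A ((s + l1) +i* t)%C) - (H s t - A (s +i* t)%C)) +
  (('i%C * V (s + l1) (t + l2) - A ((s + l1) +i* (t + l2))%C) -
      ('i%C * V (s + l1) t - A ((s + l1) +i* t)%C)) -
  ((H (s + l1) (t + l2) - A ((s + l1) +i* (t + l2))%C) - (H s (t + l2) - A (s +i* (t + l2))%C)) -
  (('i%C * V s (t + l2) - A (s +i* (t + l2))%C) -
      ('i%C * V s t - A (s +i* t)%C))); last by rewrite /rect_integral; ring.
apply: le_trans (modcB _ _) _.
apply: (@le_trans _ _ (e * (l1 + l2) * l1 + e * (l1 + l2) * l2 + e * (l1 + l2) * l1 +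
   e * (l1 + l2) * l2)); last by rewrite le_eqVlt; apply/orP; left; apply/eqP; ring.
apply: lerD; last by apply: v1; lra.
apply: le_trans (modcB _ _) _; apply: lerD; last by apply: h2; lra.
apply: le_trans (modcD _ _) _; apply: lerD; last by apply: v2; lra.
by apply: h1; lra.
Qed.

(** Bisection: if the integral is too large for the square of [l1 + l2], it is so for one of the
    quarters. The chosen quarters shrink to a point at which [rect_integral_local] contradicts
    this. *)
Theorem goursat s t l1 l2 : 0 <= l1 -> 0 <= l2 -> rect_integral s t l1 l2 = 0.
Proof.
move=> l10 l20; apply: contrapT => I0.
have Ip : 0 < modc (rect_integral s t l1 l2) by rewrite modc_gt0; apply/eqP.
have p0 : 0 < l1 + l2.
  rewrite lt_neqAle addr_ge0 // andbT eq_sym; apply/eqP => p0; apply: I0.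
  have [-> ->] : l1 = 0 /\ l2 = 0 by split; lra.
  by rewrite /rect_integral !addr0; ring.
set p := l1 + l2 in p0.
(* Half the actual ratio, so that the initial rectangle is strictly [bad]. The local estimate with
   error [k / 2] returns exactly [k], against that strict inequality. *)
pose k := modc (rect_integral s t l1 l2) / (p ^+ 2 + p ^+ 2).
have pp : 0 < p ^+ 2 by rewrite exprn_gt0.
have k0 : 0 < k by rewrite divr_gt0 // addr_gt0.
pose bad n (q : R * R) :=
  k * (p / 2 ^+ n) ^+ 2 < modc (rect_integral q.1 q.2 (l1 / 2 ^+ n) (l2 / 2 ^+ n)).
have bad0 : bad 0%N (s, t).
  rewrite /bad /= expr0 !divr1 /k.
  rewrite mulrAC ltr_pdivrMr ?addr_gt0 // mulrDr ltrDl.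
  by rewrite mulr_gt0.
(* The implication stands under the existential, with [q] itself as default when it is not [bad], so
   that choice yields a total function to iterate. *)
have step n (q : R * R) : exists q' : R * R, bad n q -> [/\ bad n.+1 q',
   q.1 <= q'.1 /\ q'.1 + l1 / 2 ^+ n.+1 <= q.1 + l1 / 2 ^+ n &
   q.2 <= q'.2 /\ q'.2 + l2 / 2 ^+ n.+1 <= q.2 + l2 / 2 ^+ n].
  have [bq|nb] := pselect (bad n q); last by exists q.
  set L1 := l1 / 2 ^+ n.+1; set L2 := l2 / 2 ^+ n.+1.
  have half l : l / 2 ^+ n = l / 2 ^+ n.+1 + l / 2 ^+ n.+1 :> R.
    by rewrite exprS; field.
  have L10 : 0 <= L1 by rewrite divr_ge0 // exprn_ge0.
  have L20 : 0 <= L2 by rewrite divr_ge0 // exprn_ge0.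
  set T := k * (p / 2 ^+ n.+1) ^+ 2.
  have := bq; rewrite /bad !half rect_integral_split -/L1 -/L2.
  have -> : k * (p / 2 ^+ n.+1 + p / 2 ^+ n.+1) ^+ 2 = T + T + T + T.
    by rewrite /T; ring.
  move=> lt4.
  have [T1|T1] := ltP T (modc (rect_integral q.1 q.2 L1 L2)).
    by exists q => _; split => //; lra.
  have [T2|T2] := ltP T (modc (rect_integral (q.1 + L1) q.2 L1 L2)).
    by exists (q.1 + L1, q.2) => _; split => //=; lra.
  have [T3|T3] := ltP T (modc (rect_integral q.1 (q.2 + L2) L1 L2)).
    by exists (q.1, q.2 + L2) => _; split => //=; lra.
  have [T4|T4] := ltP T (modc (rect_integral (q.1 + L1) (q.2 + L2) L1 L2)).
    by exists (q.1 + L1, q.2 + L2) => _; split => //=; lra.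
  exfalso; move: lt4; apply/negP; rewrite -leNgt.
  apply: le_trans (modcD _ _) _; apply: lerD => //.
  apply: le_trans (modcD _ _) _; apply: lerD => //.
  by apply: le_trans (modcD _ _) _; apply: lerD.
have /choice[next Hnext] : forall nq : nat * (R * R), exists q' : R * R,
    bad nq.1 nq.2 -> [/\ bad nq.1.+1 q',
   nq.2.1 <= q'.1 /\ q'.1 + l1 / 2 ^+ nq.1.+1 <= nq.2.1 + l1 / 2 ^+ nq.1 &
   nq.2.2 <= q'.2 /\ q'.2 + l2 / 2 ^+ nq.1.+1 <= nq.2.2 + l2 / 2 ^+ nq.1].
  by move=> [n q]; exact: step.
pose Q := nat_rect (fun=> (R * R)%type) (s, t) (fun n q => next (n, q)).
have badQ n : bad n (Q n).
  by elim: n => [//|n IH]; have [] := Hnext (n, Q n) IH.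
have [|x Hx] := @nested_halving _ (fun n => (Q n).1) _ l10.
  by move=> n; have [] := Hnext (n, Q n) (badQ n).
have [|y Hy] := @nested_halving _ (fun n => (Q n).2) _ l20.
  by move=> n; have [] := Hnext (n, Q n) (badQ n).
have [c Hc] := (derivable_modcP F (x +i* y)%C).1 (@F_entire _).
have [|d d0 Hd] := Hc (k / 2); first by rewrite divr_gt0.
have [n nd] := halving_lt p d0.
have : modc (rect_integral (Q n).1 (Q n).2 (l1 / 2 ^+ n) (l2 / 2 ^+ n)) <=
    (k / 2 + k / 2) * (l1 / 2 ^+ n + l2 / 2 ^+ n) ^+ 2.
  apply: (rect_integral_local _ Hd) => //; first by rewrite divr_gt0.
  by rewrite -mulrDl.
by rewrite -splitr -mulrDl leNgt => /negP; apply; exact: badQ.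
Qed.

End Goursat.

(** * The mean value property and the maximum principle *)

Section MeanValue.
Variable R : realType.
Local Notation C := (R[i]^o).

Definition cexp (z : C) : C := (expR (Re z))%:C * (cos (Im z) +i* sin (Im z))%C.

Lemma cexpD z w : cexp (z + w) = cexp z * cexp w.
Proof.
rewrite /cexp Re_add Im_add expRD cosD sinD; apply/eqP.
rewrite eq_complex !(Re_mul, Im_mul) /=; apply/andP; split; apply/eqP; ring.
Qed.

Lemma modc_cexp z : modc (cexp z) = expR (Re z).
Proof.
rewrite /cexp Normc.normcM modc_real ger0_norm ?expR_ge0 //= cos2Dsin2.
by rewrite sqrtr1 mulr1.
Qed.

(** The functional equation reduces the estimate at [z] to that of [cexp k - 1 - k], which follows
    from the real derivatives of [expR], [cos] and [sin] at [0]. *)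
Lemma entire_cexp : entire cexp.
Proof.
move=> z; apply/derivable_modcP; exists (cexp z) => e e0.
have M0 : 0 < modc (cexp z) by rewrite modc_cexp expR_gt0.
(* The constant 9 is the sum 1 + 3 + 3 + 2 of the coefficients in [B] below; the bound [e1 <= 1] is
   what gives [expR x <= 3]. *)
have [e1 [e10 e11 e12]] : exists e1 : R,
    [/\ 0 < e1, e1 <= 1 & e1 <= e / (modc (cexp z) * 9)].
  exists (Num.min 1 (e / (modc (cexp z) * 9))).
  by rewrite lt_min ltr01 divr_gt0 ?mulr_gt0 // !ge_min !lexx orbT.
have [r1 r10 H1] := (is_derive_normrP _ _ _).1 (is_derive_expR (0 : R)) _ e10.
have [r2 r20 H2] := (is_derive_normrP _ _ _).1 (is_derive_cos (0 : R)) _ e10.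
have [r3 r30 H3] := (is_derive_normrP _ _ _).1 (is_derive_sin (0 : R)) _ e10.
exists (Num.min e1 (Num.min r1 (Num.min r2 r3))); first by rewrite !lt_min e10 r10 r20.
move=> k; rewrite !lt_min => /and4P[ke k1 k2 k3].
have := normr_Re_le k; have := normr_Im_le k.
set x := Re k; set y := Im k => yk xk.
have {}H1 := H1 _ (le_lt_trans xk k1).
have {}H2 := H2 _ (le_lt_trans yk k2).
have {}H3 := H3 _ (le_lt_trans yk k3).
rewrite !add0r expR0 mulr1 in H1.
rewrite !add0r cos0 sin0 oppr0 mulr0 subr0 in H2.
rewrite !add0r sin0 cos0 subr0 mulr1 in H3.
have xe : `|x| <= e1 by rewrite ltW // (le_lt_trans xk).
have Ex : `|expR x - 1| <= e1 + e1.
  have -> : expR x - 1 = (expR x - 1 - x) + x by rewrite subrK.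
  apply: le_trans (ler_normD _ _) _; apply: lerD => //; apply: le_trans H1 _.
  by apply: ler_piMr; [exact: ltW | exact: le_trans e11].
have E3 : `|expR x| <= 3.
  by move: Ex; rewrite !ler_norml => /andP[? ?]; apply/andP; split; lra.
have -> : cexp (z + k) - cexp z - cexp z * k = cexp z * (cexp k - 1 - k).
  by rewrite cexpD; ring.
rewrite Normc.normcM.
have B : modc (cexp k - 1 - k) <= e1 * 9 * modc k.
  apply: le_trans (modc_le_ReIm _) _.
  have -> : Re (cexp k - 1 - k) = (expR x - 1 - x) + expR x * (cos y - 1).
    by rewrite !(Re_add, Re_opp, Re_mulr) /=; ring.
  have -> : Im (cexp k - 1 - k) = expR x * (sin y - y) + (expR x - 1) * y.
    by rewrite !(Im_add, Im_opp, Im_mulr) /= -/y; ring.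
  apply: (@le_trans _ _ ((e1 * modc k + 3 * (e1 * modc k)) +
     (3 * (e1 * modc k) + (e1 + e1) * modc k))); last first.
    by rewrite le_eqVlt; apply/orP; left; apply/eqP; ring.
  have X1 : e1 * `|x| <= e1 * modc k by rewrite ler_wpM2l // ltW.
  have Y1 : e1 * `|y| <= e1 * modc k by rewrite ler_wpM2l // ltW.
  apply: lerD; apply: le_trans (ler_normD _ _) _; apply: lerD.
  - exact: le_trans X1.
  - by rewrite normrM ler_pM // (le_trans H2).
  - by rewrite normrM ler_pM // (le_trans H3).
  - by rewrite normrM ler_pM.
apply: le_trans (ler_wpM2l (ltW M0) B) _; rewrite !mulrA; apply: ler_wpM2r.
  exact: modc_ge0.
move: e12; by rewrite ler_pdivlMr ?mulr_gt0 // mulrCA !mulrA.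
Qed.

Lemma mean_value (f : C -> C) (z0 : C) (r : R) (P : R -> C) : entire f -> 0 < r ->
  (forall t, has_deriv P t (f (z0 + r%:C * (cos t +i* sin t)%C))) ->
  P (2 * pi) - P 0 = (2 * pi)%:C * f z0.
Proof.
move=> ef r0 dP.
(* [F] has period [2 pi i], so the horizontal sides of a rectangle of height
   [2 pi] cancel: the mean over a circle does not depend on the radius. *)
pose F (z : C) := f (z0 + cexp z).
have eF : entire F.
  have eg : entire (fun z => z0 + cexp z) :=
    entireD (@entire_cst R z0) entire_cexp.
  exact: entire_comp ef eg.
have cF := entire_continuous eF.
have /choice[V HV] : forall s, exists V : R -> C, forall t, has_deriv V t (F (s +i* t)%C).
  move=> s; apply: exists_cprimitive => t.
  apply: (@continuous_comp _ _ _ (fun t : R => (s +i* t)%C : C) F); last exact: cF.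
  by apply: continuous_complex => u; [exact: cvg_cst | exact: cvg_id].
have /choice[H HH] : forall t, exists H : R -> C, forall s, has_deriv H s (F (s +i* t)%C).
  move=> t; apply: exists_cprimitive => s.
  apply: (@continuous_comp _ _ _ (fun s : R => (s +i* t)%C : C) F); last exact: cF.
  by apply: continuous_complex => u; [exact: cvg_id | exact: cvg_cst].
have p0 : 0 <= 2 * pi :> R by rewrite mulr_ge0 // pi_ge0.
have per s : F (s +i* (2 * pi))%C = F (s +i* 0)%C.
  rewrite /F; congr (f (z0 + _)); rewrite /cexp /=; congr (_ * (_ +i* _)%C).
  - by rewrite mulr_natl cos2pi cos0.
  - by rewrite mulr_natl sin2pi sin0.
have const s : s <= ln r -> V (ln r) (2 * pi) - V (ln r) 0 = V s (2 * pi) - V s 0.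
  move=> sr.
  have sr' : 0 <= ln r - s by rewrite subr_ge0.
  have := @goursat R F (fun x t => H t x) V eF (fun s t => HH t s) HV s 0 _ _ sr' p0.
  rewrite /rect_integral (addrC s) subrK add0r.
  have -> : H (2 * pi) (ln r) - H (2 * pi) s = H 0 (ln r) - H 0 s.
    apply: (has_deriv_uniq (E := fun x => F (x +i* 0)%C)) => x; last exact: HH.
    by rewrite -per; exact: HH.
  move=> E; apply/eqP; rewrite -subr_eq0.
  have i0 : ('i%C : C) != 0.
    by rewrite eq_complex /= oner_eq0 andbF.
  by rewrite -(mulrI_eq0 _ (mulfI i0)) -E; apply/eqP; ring.
have Hsmall s : V s (2 * pi) - V s 0 - (2 * pi)%:C * f z0 =
    (V s (2 * pi) - (2 * pi)%:C * f z0) - (V s 0 - 0%:C * f z0).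
  by rewrite mul0r; ring.
have -> : P (2 * pi) - P 0 = V (ln r) (2 * pi) - V (ln r) 0.
  apply: (has_deriv_uniq (E := fun t => F (ln r +i* t)%C)) => x; last exact: HV.
  rewrite (_ : F _ = f (z0 + r%:C * (cos x +i* sin x)%C)); first exact: dP.
  by rewrite /F /cexp /= lnK.
apply/eqP; rewrite -subr_eq0 -modc_eq0 eq_le modc_ge0 andbT.
apply/ler_addgt0Pl => e e0; rewrite addr0.
have pp : 0 < 2 * pi + 1 :> R by rewrite ltr_wpDl.
have [|d d0 Hd] := (continuous_modcP f z0).1 (@entire_continuous R f ef z0) (e / (2 * pi + 1)).
  by rewrite divr_gt0.
(* Abscissa [s] stands for the circle of radius [expR s]. It must not exceed [ln r] for [const] to
   apply, and the second bound puts the circle where [f] is close to [f z0]. *)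
pose s := Num.min (ln r) (ln (d / 2)).
rewrite (const s) ?ge_min ?lexx // Hsmall.
have sd : expR s < d.
  apply: (@le_lt_trans _ _ (expR (ln (d / 2)))).
    by rewrite ler_expR ge_min lexx orbT.
  by rewrite lnK ?posrE ?divr_gt0 // ltr_pdivrMr // ltr_pMr // ltr1n.
apply: (@le_trans _ _ (e / (2 * pi + 1) * (2 * pi - 0))).
  apply: (has_deriv_modc_le (G := fun t => V s t - t%:C * f z0)
    (E := fun t => F (s +i* t)%C - f z0) p0).
  - move=> t; apply: has_derivB; first exact: HV.
    move=> e1 e10; exists 1 => // k _.
    rewrite [X in modc X](_ : _ = 0); first by rewrite Normc.normc0 mulr_ge0 // ltW.
    by rewrite rmorphD /=; ring.
  - move=> t _; apply: ltW; apply: Hd.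
    by rewrite (addrC z0) addrK modc_cexp.
rewrite subr0 mulrAC ler_pdivrMr // ler_pM2l //.
by rewrite lerDl.
Qed.

(** As [G] is open and its union with [K] is compact, the boundary of [G] lies in [K]. This form
    needs no description of that boundary, which suits the hulls below. *)
Lemma maximum_principle (G K : set C) (h : C -> C) (m : R) : entire h ->
  open G -> compact (G `|` K) -> (forall z, K z -> modc (h z) <= m) ->
  forall z, G z -> modc (h z) <= m.
Proof.
move=> eh oG cK Hm z0 Gz0; rewrite leNgt; apply/negP => mM.
set M := modc (h z0) in mM.
(* A unimodular factor that turns [h z0] into its modulus [M]; any unit would do when [h z0 = 0]. *)
pose w : C := if h z0 == 0 then 1 else conjc (h z0) / M%:C.
have modcJ z : modc (conjc z) = modc z :> R.
  by case: z => p q /=; rewrite sqrrN.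
have wh : Re (w * h z0) = M /\ modc w = 1.
  rewrite /w; case: eqVneq => [E|N0].
    by rewrite /M E mul1r Normc.normc0 Normc.normc1.
  have M0 : 0 < M by rewrite modc_gt0.
  have Mi : M != 0 by rewrite gt_eqF.
  split.
    rewrite mulrAC -rmorphV ?unitfE //= mulrC Re_mulr mulrC.
    rewrite (_ : Re (_ * _) = M ^+ 2); first by rewrite expr2 mulfK.
    by rewrite /M modc_sqr; case: (h z0) => p q /=; ring.
  rewrite Normc.normcM modcJ Normc.normcV modc_real ger0_norm ?(ltW M0) //.
  by rewrite -/M divff.
have [b b0 Hb] := compact_modc_bounded cK.
have [w1 w2] := wh.
have bz z : (G `|` K) z -> modc (z - z0) ^+ 2 <= (b + b) ^+ 2.
  move=> Kz; rewrite ler_pXn2r ?nnegrE ?modc_ge0 ?addr_ge0 ?(ltW b0) //.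
  by apply: le_trans (modcB _ _) _; apply: lerD; apply: Hb => //; left.
have B0 : 0 < (b + b) ^+ 2 by rewrite exprn_gt0 // addr_gt0.
(* With this [e] the quadratic term of [u] is at most [(M - m) / 2] on the compact set. Hence [u]
   stays below [M = u z0] on [K], and its maximum is attained in [G]. *)
pose e := (M - m) / ((b + b) ^+ 2 + (b + b) ^+ 2).
have e0 : 0 < e by apply: divr_gt0; [rewrite subr_gt0 | exact: addr_gt0].
(* [u] is strictly subharmonic, so it has no interior maximum. *)
pose u (z : C) : R := Re (w * h z) + e * modc (z - z0) ^+ 2.
have cRe : continuous (fun z : C => Re (w * h z) : R).
  move=> z; apply: (@continuous_comp _ _ _ (fun z : C => w * h z : C) (@Re R : C -> R)).
    exact: (@entire_continuous R _ (entireM (@entire_cst R w) eh)).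
  exact: continuous_Re.
have cmod : continuous (fun z : C => modc (z - z0) : R).
  move=> z; apply: (@continuous_comp _ _ _ (fun z : C => z - z0 : C) (@modc R : C -> R)).
    exact: (@entire_continuous R _ (entireB (@entire_id R) (@entire_cst R z0))).
  exact: continuous_modc.
have cu : continuous u.
  move=> z; exact: (cvgD (cRe z) (cvgM (cvg_cst e) (cvgM (cmod z) (cmod z)))).
have [|z1 /set_mem Kz1 Hz1] := compact_EVT_max _ cK (continuous_subspaceT cu).
  by exists z0; left.
have u0 : u z0 = M by rewrite /u w1 subrr Normc.normc0 expr0n mulr0 addr0.
have Gz1 : G z1.
  case: Kz1 => // Kz1; exfalso.
  have : u z0 <= u z1 by apply: Hz1; rewrite inE; left.
  apply/negP; rewrite -ltNge u0 /u.
  have A1 : Re (w * h z1) <= m.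
    apply: le_trans (ler_norm _) _; apply: le_trans (normr_Re_le _) _.
    by rewrite Normc.normcM w2 mul1r Hm.
  have A2 : e * modc (z1 - z0) ^+ 2 <= (M - m) / 2.
    apply: (@le_trans _ _ (e * (b + b) ^+ 2)).
      by rewrite ler_wpM2l ?(ltW e0) // bz //; right.
    rewrite le_eqVlt; apply/orP; left; apply/eqP; rewrite /e; field.
    by rewrite gt_eqF // addr_gt0.
  lra.
have /nbhs_modcP[r r0 Hr] : nbhs z1 G by apply: open_nbhs_nbhs.
have q0 : 0 < r / 2 by rewrite divr_gt0.
have qr : r / 2 < r by rewrite ltr_pdivrMr // ltr_pMr // ltr1n.
set q := r / 2 in q0 qr.
pose b1 := z1 - z0.
(* Expanding the squared distance to [z0] around [z1] leaves a cross term that is the real part of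
   an affine function. Absorbed into [k], it keeps [k] entire, so that the mean value property
   applies. *)
pose k (z : C) : C := w * h z + (2 * e)%:C * conjc b1 * (z - z1).
have ek : entire k := entireD (entireM (@entire_cst R w) eh)
  (entireM (@entire_cst R ((2 * e)%:C * conjc b1)) (entireB (@entire_id R) (@entire_cst R z1))).
have uk z : u z = Re (k z) + e * (modc b1 ^+ 2 + modc (z - z1) ^+ 2).
  rewrite /u /k Re_add -addrA; congr (_ + _).
  rewrite !modc_sqr /b1 -mulrA Re_mulr.
  by case: (z) (z1) (z0) => a1 a2 [c1 c2] [d1 d2] /=; ring.
pose circ (t : R) : C := z1 + q%:C * (cos t +i* sin t)%C.
have mc t : modc (circ t - z1) = q.
  rewrite /circ (addrC z1) addrK Normc.normcM modc_real ger0_norm ?(ltW q0) //=.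
  by rewrite cos2Dsin2 sqrtr1 mulr1.
have [|P dP] := @exists_cprimitive R (fun t => k (circ t)).
  move=> t; apply: (@continuous_comp _ _ _ circ k); last exact: (entire_continuous ek).
  apply: cvgD; first exact: cvg_cst.
  apply: cvgM; first exact: cvg_cst.
  by apply: continuous_complex => s; [exact: continuous_cos | exact: continuous_sin].
have MV := mean_value ek q0 dP.
have p0 : 0 < 2 * pi :> R by rewrite mulr_gt0 // pi_gt0.
have dg t := has_deriv_Re (dP t).
(* Instead of averaging an inequality over the circle, one angle [c] is found at which [Re k] equals
   its mean [Re (k z1)]; [kc] contradicts this. *)
have [|c cab Ec] := MVT_segment (f := fun t => Re (P t)) (df := fun t => Re (k (circ t)))
   (ltW p0) (fun x _ => dg x).
  by apply: derivable_within_continuous => x _; have [] := dg x.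
have kc : Re (k (circ c)) <= Re (k z1) - e * q ^+ 2.
  have : u (circ c) <= u z1.
    by apply: Hz1; rewrite inE; left; apply: Hr; rewrite mc.
  by rewrite !uk mc subrr Normc.normc0 expr0n /= addr0 mulrDr; lra.
have : Re (P (2 * pi) - P 0) = Re ((2 * pi)%:C * k z1) by rewrite MV.
rewrite Re_add Re_opp Re_mulr Ec subr0 mulrC.
move/(mulfI (lt0r_neq0 p0)) => E.
have : 0 < e * q ^+ 2 by rewrite mulr_gt0 // exprn_gt0.
lra.
Qed.

End MeanValue.

(** * Liouville's theorem and the density of the image *)

Section Liouville.
Variable R : realType.
Local Notation C := (R[i]^o).
Implicit Types (f h q : C -> C).

(* [(h z - h 0)^2 / z] is again entire, its derivative at [0] being [h'(0)^2]:
   no removable singularity theorem is needed. *)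
Lemma entire_sqr_quotient h : entire h ->
  entire (fun z => (h z - h 0) ^+ 2 / z).
Proof.
move=> eh z; have [->|z0] := eqVneq z 0; last first.
  have eD := (entire_differentiable _).1 (entire_sqr (entireB eh (@entire_cst R (h 0)))).
  have iD := (entire_differentiable _).1 (@entire_id R).
  apply/derivable1_diffP; exact: differentiableM (eD z) (differentiableV (iD z) z0).
have [c Hc] := (derivable_modcP h 0).1 (eh 0).
apply/derivable_modcP; exists (c ^+ 2) => e e0.
have c0 : 0 < 1 + 2 * modc c by rewrite ltr_wpDr // mulr_ge0 // modc_ge0.
have [e1 [e10 e11 e12]] : exists e1 : R,
    [/\ 0 < e1, e1 <= 1 & e1 * (1 + 2 * modc c) <= e].
  exists (Num.min 1 (e / (1 + 2 * modc c))).
  rewrite lt_min ltr01 divr_gt0 // !ge_min lexx; split => //.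
  by rewrite -ler_pdivlMr // ge_min lexx orbT.
have [d d0 Hd] := Hc _ e10; exists d => // k kd.
(* At [0] the quotient takes the value [0], which is also its limit there: the numerator vanishes to
   order at least two. *)
rewrite add0r subrr expr0n mul0r subr0.
have [->|k0] := eqVneq k 0.
  by rewrite subrr expr0n !mul0r mulr0 subrr Normc.normc0 mulr0.
have mk : 0 < modc k by rewrite modc_gt0.
have := Hd k kd; rewrite add0r; set D := h k - h 0 => HD.
rewrite (_ : _ - _ = (D - c * k) * (D - c * k + 2 * c * k) / k); last by field.
rewrite 2!Normc.normcM Normc.normcV ler_pdivrMr //.
have H2 : modc (D - c * k + 2 * c * k) <= (1 + 2 * modc c) * modc k.
  have -> : (1 + 2 * modc c) * modc k = modc k + 2 * modc c * modc k by ring.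
  apply: le_trans (modcD _ _) _; apply: lerD.
    by apply: le_trans HD _; rewrite ler_piMl // modc_ge0.
  rewrite !Normc.normcM (_ : modc 2 = 2) //.
  by rewrite -(rmorph_nat (real_complex R)) modc_real normr_nat.
apply: (@le_trans _ _ ((e1 * modc k) * ((1 + 2 * modc c) * modc k))).
  by apply: ler_pM; rewrite ?modc_ge0.
have -> : e1 * modc k * ((1 + 2 * modc c) * modc k) =
  e1 * (1 + 2 * modc c) * modc k * modc k by ring.
by rewrite !ler_wpM2r ?modc_ge0.
Qed.

Lemma open_modc_lt (r : R) : open [set z : C | modc z < r].
Proof.
by apply: (@open_comp C R (@modc R) [set x | x < r]);
  [move=> x _; exact: continuous_modc | exact: open_lt].
Qed.

Lemma compact_modc_le (r : R) : compact [set z : C | modc z <= r].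
Proof.
apply: (@closed_bounded_compact R _ r) => //.
by apply: (@closed_comp C R (@modc R) [set x | x <= r]);
  [move=> x _; exact: continuous_modc | exact: closed_le].
Qed.

(** On the circle of radius [r] the entire quotient [(h z - h 0) ^+ 2 / z] is at most
    [(M + M) ^+ 2 / r]. By the maximum principle this bounds it inside as well, for every [r]. *)
Lemma liouville h (M : R) : entire h -> (forall z, modc (h z) <= M) ->
  forall z, h z = h 0.
Proof.
move=> eh HM z; apply/eqP; rewrite -subr_eq0 -modc_eq0 eq_le modc_ge0 andbT.
have M0 : 0 <= M by apply: le_trans (HM 0); exact: modc_ge0.
have [->|z0] := eqVneq z 0; first by rewrite subrr Normc.normc0.
have mz : 0 < modc z by rewrite modc_gt0.
rewrite leNgt; apply/negP; set d := modc (h z - h 0) => d0.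
(* The first entry puts [z] inside the circle; the second makes the bound smaller than
   [d ^+ 2 / modc z], the modulus of the quotient at [z]. *)
pose r := Num.max (modc z + 1) ((M + M) ^+ 2 * modc z / d ^+ 2 + 1).
have r0 : 0 < r by rewrite lt_max ltr_wpDl // ltW.
pose k z := (h z - h 0) ^+ 2 / z.
have : modc (k z) <= (M + M) ^+ 2 / r.
  apply: (@maximum_principle R [set z | modc z < r] [set z | modc z = r]).
  - exact: entire_sqr_quotient.
  - exact: open_modc_lt.
  - rewrite (_ : _ `|` _ = [set z | modc z <= r]); first exact: compact_modc_le.
    apply/seteqP; split => w /=; first by case=> [/ltW|->].
    by rewrite le_eqVlt => /orP[/eqP|]; [right | left].
  - move=> w /= wr; rewrite /k Normc.normcM modcX Normc.normcV wr.
    apply: ler_wpM2r; first by rewrite invr_ge0 ltW.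
    rewrite ler_pXn2r ?nnegrE ?modc_ge0 ?addr_ge0 //.
    by apply: le_trans (modcB _ _) _; exact: lerD.
  - by rewrite /= /r lt_max ltrDl ltr01.
rewrite /k Normc.normcM modcX Normc.normcV -/d ler_pdivrMr // leNgt => /negP; apply.
rewrite mulrAC ltr_pdivrMr // [X in _ < X]mulrC -ltr_pdivrMr ?exprn_gt0 //.
by rewrite /r lt_max ltrDl ltr01 orbT.
Qed.

(** Otherwise [(q z - w)^-1] would be entire and bounded by [r^-1], hence constant. *)
Lemma entire_dense q (w : C) (r : R) : entire q -> ~ (forall z, q z = q 0) -> 0 < r ->
  exists z, modc (q z - w) < r.
Proof.
move=> eq nc r0; apply: contrapT => H; apply: nc => z.
have ge_r y : r <= modc (q y - w).
  by rewrite leNgt; apply/negP => qr; apply: H; exists y.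
have nz y : q y - w != 0 by rewrite -modc_gt0 (lt_le_trans r0).
have eB : entire (fun z => q z - w) := entireB eq (@entire_cst R w).
have eV := entireV eB nz.
have : (q z - w)^-1 = (q 0 - w)^-1.
  apply: (@liouville _ r^-1 eV) => y.
  by rewrite Normc.normcV lef_pV2 // posrE (lt_le_trans r0).
by move/(congr1 (fun t => t^-1 + w)); rewrite !invrK !subrK.
Qed.

End Liouville.

(** * Continuous square roots *)

Section SquareRoot.
Variable R : realType.
Local Notation C := (R[i]^o).
Implicit Types (f h g L : C -> C) (K : set C).

(* The principal square root: [(u + |u|)^2 = u (2 |u| + 2 Re u)]. *)
Definition csqrt (u : C) : C :=
  (u + (modc u)%:C) * ((Num.sqrt (2 * modc u + 2 * Re u))^-1)%:C.

Lemma sqr_csqrt u : 0 < Re u -> csqrt u ^+ 2 = u.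
Proof.
move=> u0; rewrite /csqrt exprMn -rmorphXn exprVn.
have p : 0 < 2 * modc u + 2 * Re u.
  by rewrite ltr_wpDl ?mulr_ge0 ?modc_ge0 // mulr_gt0.
rewrite sqr_sqrtr ?(ltW p) //.
have E : (u + (modc u)%:C) ^+ 2 = u * (2 * modc u + 2 * Re u)%:C.
  have := modc_sqr u; move: (modc u) => m; case: u {u0 p} => a b /= mE.
  apply/eqP; rewrite eq_complex /=; apply/andP; split; apply/eqP; last by ring.
  rewrite !expr2 in mE *; ring: mE.
by rewrite E -mulrA -rmorphM mulfV ?gt_eqF // mulr1.
Qed.

Lemma continuous_csqrt u : 0 < Re u -> {for u, continuous csqrt}.
Proof.
move=> u0; have p : 0 < 2 * modc u + 2 * Re u.
  by rewrite ltr_wpDl ?mulr_ge0 ?modc_ge0 // mulr_gt0.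
pose v (x : C) : R := (Num.sqrt (2 * modc x + 2 * Re x))^-1.
have creal (f : C -> R) : {for u, continuous f} -> {for u, continuous (fun x => (f x)%:C : C)}.
  move=> cf; apply: (@continuous_comp _ _ _ f (fun t : R => t%:C : C)) => //.
  by apply: (@continuous_complex R R id (fun=> 0)) => s; [exact: cvg_id | exact: cvg_cst].
have cin : {for u, continuous (fun x : C => 2 * modc x + 2 * Re x : R)}.
  exact: (cvgD (cvgM (cvg_cst (2 : R)) (@continuous_modc R u))
               (cvgM (cvg_cst (2 : R)) (@continuous_Re R u))).
have cv : {for u, continuous v}.
  have s0 : Num.sqrt (2 * modc u + 2 * Re u) != 0 by rewrite sqrtr_eq0 -ltNge.
  have cs : {for u, continuous (fun x : C => Num.sqrt (2 * modc x + 2 * Re x) : R)}.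
    apply: (@continuous_comp C R R (fun x : C => 2 * modc x + 2 * Re x : R) (@Num.sqrt R)).
      exact: cin.
    exact: sqrt_continuous.
  exact: (cvgV s0 cs).
exact: (cvgM (cvgD cvg_id (creal _ (@continuous_modc R u))) (creal v cv)).
Qed.

Definition has_sqrt K h := exists2 L : C -> C, {within K, continuous L} &
  forall x, K x -> L x ^+ 2 = h x.

Lemma has_sqrt_cst K (c : C) : has_sqrt K (fun=> c).
Proof.
exists (fun=> sqrtc c); last by move=> x _; exact: sqr_sqrtc.
by apply: continuous_subspaceT; exact: (@cst_continuous C C).
Qed.

(** The quotient [g / h] stays at distance less than [1] from [1], hence in the right half-plane,
    where the principal root is continuous. *)
Lemma has_sqrt_perturb K h g : continuous h -> continuous g ->
  (forall x, K x -> modc (g x - h x) < modc (h x)) ->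
  has_sqrt K h -> has_sqrt K g.
Proof.
move=> ch cg near [L cL LE].
have hn x : K x -> h x != 0.
  by move=> /near; rewrite -modc_gt0; apply: le_lt_trans; exact: modc_ge0.
have Re0 x : K x -> 0 < Re (g x / h x).
  move=> Kx; have h0 := hn _ Kx.
  have : modc (g x / h x - 1) < 1.
    have -> : g x / h x - 1 = (g x - h x) / h x by field.
    by rewrite Normc.normcM Normc.normcV ltr_pdivrMr ?mul1r ?modc_gt0 // near.
  move/(le_lt_trans (normr_Re_le _)).
  by rewrite Re_add Re_opp /= ltr_norml => /andP[? ?]; lra.
exists (fun x => L x * csqrt (g x / h x)); last first.
  move=> x Kx; rewrite exprMn LE // sqr_csqrt ?Re0 //; field; exact: hn.
have cR : {within K, continuous (fun x => csqrt (g x / h x))}.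
  apply: continuous_in_subspaceT => x /set_mem Kx.
  apply: (@continuous_comp _ _ _ (fun x => g x / h x : C)); last first.
    by apply: continuous_csqrt; exact: Re0.
  exact: (cvgM (cg x) (cvgV (hn x Kx) (ch x))).
by move=> x; exact: (cvgM (cL x) (cR x)).
Qed.

(** Two square roots of one function differ by a sign, and a continuous sign is constant on a
    connected set. *)
Lemma sqrt_ratio_cst K L1 L2 : connected K ->
  {within K, continuous L1} -> {within K, continuous L2} ->
  (forall x, K x -> L1 x ^+ 2 = L2 x ^+ 2) -> (forall x, K x -> L2 x != 0) ->
  forall x y, K x -> K y -> L1 x / L2 x = L1 y / L2 y.
Proof.
move=> cK c1 c2 E nz.
have c12 : {within K, continuous (fun x => L1 x / L2 x)}.
  apply/(@subspace_continuousP C K C) => y Ky.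
  have FF : Filter (within K (nbhs y)) by exact: within_filter.
  exact: (cvgM ((@subspace_continuousP C K C L1).1 c1 y Ky)
    (cvgV (nz y Ky) ((@subspace_continuousP C K C L2).1 c2 y Ky))).
apply: (connected_sign_cst cK c12) => y Ky.
have /eqP := E y Ky; rewrite eqf_sqr => /orP[]/eqP ->.
  by left; rewrite mulfV // nz.
by right; rewrite mulNr mulfV // nz.
Qed.

Lemma has_sqrt_uniq K L1 L2 x0 : connected K -> K x0 ->
  {within K, continuous L1} -> {within K, continuous L2} ->
  (forall x, K x -> L1 x ^+ 2 = L2 x ^+ 2) -> (forall x, K x -> L2 x != 0) ->
  L1 x0 = L2 x0 -> forall x, K x -> L1 x = L2 x.
Proof.
move=> cK Kx0 c1 c2 E nz E0 x Kx.
have := sqrt_ratio_cst cK c1 c2 E nz Kx Kx0.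
by rewrite E0 mulfV ?nz // => /(canRL (mulfVK (nz _ Kx))); rewrite mul1r.
Qed.

End SquareRoot.

(** * Square roots of zero-free entire functions *)

Section EntireSquareRoot.
Variable R : realType.
Local Notation C := (R[i]^o).
Implicit Types (f h q L : C -> C) (K : set C).

Lemma compact_uniform_continuous K h (e : R) : compact K -> continuous h -> 0 < e ->
  exists2 d : R, 0 < d &
    forall x y, K x -> modc (x - y) < d -> modc (h x - h y) < e.
Proof.
move=> cK ch e0; have e2 : 0 < e / 2 by rewrite divr_gt0.
pose P (d : R) (x : C) := forall y, modc (x - y) < d -> modc (h x - h y) < e.
suff [d [d0 dP]] : exists d, 0 < d /\ K `<=` P d.
  by exists d => // x y Kx; exact: dP.
have H : \forall d \near (0 : R)^'+, K `<=` P d.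
  apply: ((@compact_near_coveringP C K).1 cK R (0 : R)^'+ P).
  move=> x Kx; have [d d0 Hd] := (continuous_modcP h x).1 (@ch x) _ e2.
  have d2 : 0 < d / 2 by rewrite divr_gt0.
  exists ([set y : C | modc (y - x) < d / 2], [set t : R | t < d / 2]).
    split; first by apply/nbhs_modcP; exists (d / 2).
    by apply: nbhs_right_lt.
  move=> [x' t] /= [x'd td] y yd.
  have H1 : modc (h x' - h x) < e / 2.
    by apply: Hd; apply: lt_trans x'd _; rewrite ltr_pdivrMr // ltr_pMr // ltr1n.
  have H2 : modc (h y - h x) < e / 2.
    apply: Hd; apply: le_lt_trans (modc_triangle x' _ _) _.
    rewrite [d]splitr; apply: ltrD => //; rewrite modc_distrC.
    exact: lt_trans td.
  apply: le_lt_trans (modc_triangle (h x) _ _) _.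
  by rewrite [e]splitr; apply: ltrD => //; rewrite modc_distrC.
have : \forall d \near (0 : R)^'+, 0 < d /\ K `<=` P d.
  by apply: filterI => //; exact: nbhs_right_gt.
by move/filter_ex.
Qed.

Lemma connected_modc_le (r : R) : 0 <= r -> connected [set z : C | modc z <= r].
Proof.
move=> r0; apply: (@connected_segments _ 0); first by rewrite /mkset Normc.normc0.
move=> z /= zr t /andP[t0 t1]; rewrite add0r subr0 Normc.normcM modc_real ger0_norm //.
by apply: le_trans zr; rewrite ler_piMl ?modc_ge0.
Qed.

(** The dilations [h (t * z)] deform the constant [h 0] into [h]. In small enough steps of [t] each
    is a perturbation of the preceding one, relative to the minimum modulus of [h] on the disk. *)
Lemma has_sqrt_disk h (r : R) : continuous h -> (forall z, h z != 0) -> 0 <= r ->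
  has_sqrt [set z : C | modc z <= r] h.
Proof.
move=> ch h0 r0; set B := [set z : C | modc z <= r].
have cB : compact B := @compact_modc_le R r.
have B0 : B 0 by rewrite /B /mkset Normc.normc0.
have cm : continuous (fun z : C => modc (h z) : R).
  move=> z; apply: (@continuous_comp C C R h (@modc R)); first exact: ch.
  exact: continuous_modc.
have [|z1 /set_mem Bz1 Hz1] := compact_EVT_min _ cB (continuous_subspaceT cm).
  by exists 0.
have m0 : 0 < modc (h z1) by rewrite modc_gt0.
have [d d0 Hd] := compact_uniform_continuous cB ch m0.
(* With [N > r / d], consecutive dilations move a point of the disk by less than [d]. *)
set N := (Num.truncn (r / d)).+1.
have Nr : r / d < N%:R by rewrite truncnS_gt.
have N0 : 0 < N%:R :> R by rewrite ltr0n.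
have step k : (k <= N)%N -> has_sqrt B (fun z => h ((k%:R / N%:R)%:C * z)).
  elim: k => [_|k IH kN].
    rewrite (_ : (fun z => _) = (fun=> h 0)); first exact: has_sqrt_cst.
    by apply/funext => z; rewrite !mul0r.
  have ck (n : nat) : continuous (fun z : C => h ((n%:R / N%:R)%:C * z)).
    move=> z; apply: (@continuous_comp C C C (fun z => (n%:R / N%:R)%:C * z) h).
      exact: (@entire_continuous R _ (entireM (@entire_cst R (n%:R / N%:R)%:C) (@entire_id R))).
    exact: ch.
  apply: (has_sqrt_perturb (ck k) (ck k.+1)); last exact: (IH (ltnW kN)).
  move=> z Bz; have By : B ((k%:R / N%:R)%:C * z).
    rewrite /B /= Normc.normcM modc_real ger0_norm ?divr_ge0 //.
    apply: le_trans Bz; rewrite ler_piMl ?modc_ge0 // ler_pdivrMr // mul1r ler_nat.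
    exact: ltnW.
  apply: (@lt_le_trans _ _ (modc (h z1))); last by apply: Hz1; rewrite inE.
  rewrite modc_distrC; apply: Hd => //.
  rewrite -mulrBl -rmorphB /= Normc.normcM modc_real -mulrBl.
  rewrite -natr1 opprD addrA subrr add0r mulN1r normrN ger0_norm ?invr_ge0 ?ler0n //.
  rewrite mulrC ltr_pdivrMr //; apply: le_lt_trans Bz _.
  by rewrite mulrC -ltr_pdivrMr.
have := step N (leqnn N); rewrite divff ?gt_eqF //.
by rewrite (_ : (fun z => _) = h) //; apply/funext => z; rewrite mul1r.
Qed.

(** With [D] the increment of [q], that of [h] is [D * (D + 2 * q z)]. By continuity the second
    factor stays away from [0], so [D] is of the order of [k], and the error left after division by
    [2 * q z] is quadratic in [D]. *)
Lemma entire_of_sqr q h : continuous q -> entire h -> (forall z, q z ^+ 2 = h z) ->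
  (forall z, q z != 0) -> entire q.
Proof.
move=> cq eh qh q0 z; have [c Hc] := (derivable_modcP h z).1 (eh z).
apply/derivable_modcP; exists (c / (2 * q z)) => e e0.
have W0 : 0 < modc (q z) by rewrite modc_gt0.
have A0 : 0 < modc c + 1 by rewrite ltr_wpDl ?modc_ge0.
set W := modc (q z) in W0.
have [e1 [e10 e11 e12]] : exists e1 : R, [/\ 0 < e1, e1 <= 1 & e1 <= e * W].
  exists (Num.min 1 (e * W)).
  by rewrite lt_min ltr01 mulr_gt0 // !ge_min !lexx orbT.
(* As a bound on [D], [e2 <= W] keeps [D + 2 * q z] of modulus at least [W]; the last condition
   makes [D ^+ 2] small relative to [k]. *)
have [e2 [e20 e21 e22]] : exists e2 : R,
    [/\ 0 < e2, e2 <= W & e2 * ((modc c + 1) / W) <= e * W].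
  exists (Num.min W (e * W / ((modc c + 1) / W))).
  rewrite lt_min W0 !divr_gt0 ?mulr_gt0 ?divr_gt0 // !ge_min !lexx; split => //.
  by rewrite -ler_pdivlMr ?divr_gt0 // ge_min lexx orbT.
have [d1 d10 Hd1] := Hc _ e10.
have [d2 d20 Hd2] := (continuous_modcP q z).1 (@cq z) _ e20.
exists (Num.min d1 d2); first by rewrite lt_min d10.
move=> k; rewrite lt_min => /andP[k1 k2].
have {}Hd1 := Hd1 _ k1.
have := Hd2 (z + k); rewrite (addrC z) addrK => /(_ k2); rewrite (addrC k).
set D := q (z + k) - q z => D2.
set E := h (z + k) - h z in Hd1.
have ED : E = D * (D + 2 * q z) by rewrite /E /D -!qh; ring.
have mE : modc E <= (modc c + 1) * modc k.
  have -> : E = (E - c * k) + c * k by rewrite subrK.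
  apply: le_trans (modcD _ _) _; rewrite mulrDl mul1r addrC Normc.normcM lerD2l.
  by apply: le_trans Hd1 _; rewrite ler_piMl ?modc_ge0.
have m2 : modc (2 : C) = 2.
  by rewrite -(rmorph_nat (real_complex R)) modc_real normr_nat.
have mDW : W <= modc (D + 2 * q z).
  have : modc (2 * q z) <= modc (D + 2 * q z) + modc D.
    have {1}-> : 2 * q z = (D + 2 * q z) - D by ring.
    exact: modcB.
  by rewrite Normc.normcM m2 -/W; lra.
have mD : modc D <= (modc c + 1) / W * modc k.
  rewrite mulrAC ler_pdivlMr //; apply: le_trans mE; rewrite ED Normc.normcM.
  by rewrite ler_wpM2l // modc_ge0.
have mDD : modc (D ^+ 2) <= e * W * modc k.
  rewrite modcX expr2; apply: (@le_trans _ _ (e2 * ((modc c + 1) / W * modc k))).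
    by apply: ler_pM; rewrite ?modc_ge0 // ltW.
  by rewrite mulrA ler_wpM2r // modc_ge0.
have -> : D - c / (2 * q z) * k = ((E - c * k) - D ^+ 2) / (2 * q z).
  by rewrite ED; field; rewrite q0.
rewrite Normc.normcM Normc.normcV Normc.normcM m2 -/W ler_pdivrMr ?mulr_gt0 //.
apply: le_trans (modcB _ _) _.
have -> : e * modc k * (2 * W) = e * W * modc k + e * W * modc k by ring.
apply: lerD => //; apply: le_trans Hd1 _.
by rewrite ler_wpM2r // modc_ge0.
Qed.

(** The roots on the disks of radius [n] are normalised, up to a sign, to the same value at [0]. By
    uniqueness they then agree on smaller disks and glue. *)
Lemma exists_entire_sqrt h : entire h -> (forall z, h z != 0) ->
  exists2 q, entire q & forall z, q z ^+ 2 = h z.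
Proof.
move=> eh h0; have ch := entire_continuous eh.
pose B (n : nat) := [set z : C | modc z <= n%:R].
have B0 n : B n 0 by rewrite /B /mkset Normc.normc0.
have /choice[L HL] : forall n, exists L : C -> C, [/\ {within B n, continuous L},
    forall z, B n z -> L z ^+ 2 = h z & L 0 = sqrtc (h 0)].
  move=> n; have [L cL LE] := has_sqrt_disk ch h0 (ler0n R n).
  have /eqP := LE _ (B0 n); rewrite -{1}[h 0]sqr_sqrtc eqf_sqr => /orP[]/eqP E.
    by exists L.
  exists (fun z => - L z); split.
  - by move=> z; exact: (cvgN (cL z)).
  - by move=> z Bz; rewrite sqrrN LE.
  - by rewrite E opprK.
have L0 n z : B n z -> L n z != 0.
  move=> Bz; have [_ /(_ z Bz) LE _] := HL n.
  by have := h0 z; rewrite -LE expf_eq0.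
have Lnm n m z : (n <= m)%N -> B n z -> L n z = L m z.
  move=> nm; have [cn En n0] := HL n; have [cm Em m0] := HL m.
  have sub : B n `<=` B m.
    by move=> w wn; apply: le_trans wn _; rewrite ler_nat.
  apply: (has_sqrt_uniq (connected_modc_le (ler0n R n)) (B0 n) cn).
  - exact: (continuous_subspaceW sub cm).
  - by move=> w wn; rewrite En // Em //; exact: sub.
  - by move=> w /sub; exact: L0.
  - by rewrite n0 m0.
pose N (z : C) := (Num.truncn (modc z)).+1.
have NB z : modc z < (N z)%:R by rewrite truncnS_gt.
pose q z := L (N z) z.
have qL n z : B n z -> q z = L n z.
  move=> Bz; have Bz' : B (N z) z by exact: ltW.
  by case: (leqP n (N z)) => [nN|/ltnW nN]; [symmetry|]; apply: Lnm.
have qh z : q z ^+ 2 = h z.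
  by have [_ E _] := HL (N z); apply: E; exact: ltW.
have q0 z : q z != 0 by apply: L0; exact: ltW.
suff cq : continuous q by exists q => [|//]; exact: entire_of_sqr cq eh qh q0.
move=> z.
have [cL _ _] := HL (N z).
pose U := [set w : C | modc w < (N z)%:R].
have UB : U `<=` B (N z) by move=> w; exact: ltW.
have oU : open U := @open_modc_lt R _.
have cU := continuous_subspaceW UB cL.
have cz : {for z, continuous (L (N z))}.
  by move: cU; rewrite continuous_open_subspace // => /(_ z); apply; rewrite inE; exact: NB.
apply/continuous_modcP => e e0.
have [d d0 Hd] := (continuous_modcP _ _).1 cz e e0.
have /nbhs_modcP[d' d'0 Hd'] : nbhs z U by apply: open_nbhs_nbhs; split => //; exact: NB.
exists (Num.min d d'); first by rewrite lt_min d0.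
move=> y; rewrite lt_min => /andP[yd yd'].
by rewrite (qL (N z) y) ?Hd //; apply: UB; exact: Hd'.
Qed.

End EntireSquareRoot.

(** * The region around which a compact set winds *)

Section Hull.
Variable R : realType.
Local Notation C := (R[i]^o).
Variable K : set C.
Hypothesis compactK : compact K.

Lemma compact_dist (z : C) : ~ K z -> exists2 r : R, 0 < r & forall x, K x -> r <= modc (x - z).
Proof.
move=> nKz; have cK := compact_closed (@hausdorffC R) compactK.
have /nbhs_modcP[r r0 Hr] : nbhs z (~` K).
  by apply: open_nbhs_nbhs; split => //; exact: closed_openC.
by exists r => // x Kx; rewrite leNgt; apply/negP => /Hr.
Qed.

Lemma continuous_translate (z : C) : continuous (fun x : C => x - z).
Proof. exact: (@entire_continuous R _ (entireB (@entire_id R) (@entire_cst R z))). Qed.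

(** Moving [z] by less than half its distance to [K] makes each of [x - z] and [x - z'] a
    perturbation of the other on [K]. *)
Lemma has_sqrt_translate_local (z : C) : ~ K z -> exists2 r : R, 0 < r &
  forall z', modc (z' - z) < r -> ~ K z' /\
   (has_sqrt K (fun x => x - z) <-> has_sqrt K (fun x => x - z')).
Proof.
move=> nKz; have [r r0 Hr] := compact_dist nKz.
have r2 : 0 < r / 2 by rewrite divr_gt0.
exists (r / 2) => // z' zz'.
have far x : K x -> r / 2 <= modc (x - z').
  move=> /Hr rx; have := modc_triangle z' x z; rewrite [r]splitr in rx.
  by move=> T; lra.
split.
  by move=> /far; rewrite subrr Normc.normc0 leNgt r2.
split; apply: has_sqrt_perturb; try exact: continuous_translate.
- move=> x Kx; have -> : x - z' - (x - z) = z - z' by ring.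
  rewrite modc_distrC (lt_le_trans zz') // (le_trans _ (Hr _ Kx)) //.
  by rewrite [X in _ <= X]splitr lerDl ltW.
- move=> x Kx; have -> : x - z - (x - z') = z' - z by ring.
  by rewrite (lt_le_trans zz') // far.
Qed.

(** Far away, [x - z] is a perturbation of the constant [- z]. *)
Lemma has_sqrt_translate_far : exists b : R, forall z, b < modc z ->
  ~ K z /\ has_sqrt K (fun x => x - z).
Proof.
have [b b0 Hb] := compact_modc_bounded compactK; exists b => z bz; split.
  by move=> /Hb; rewrite leNgt bz.
apply: (@has_sqrt_perturb _ _ (fun=> - z)); last exact: has_sqrt_cst.
- exact: (@cst_continuous C C).
- exact: continuous_translate.
- by move=> x Kx; rewrite opprK subrK normcN (le_lt_trans _ bz) // Hb.
Qed.

(* The points around which [K] winds: the square root detects the parity of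
   the winding number. *)
Definition hull : set C := [set z | ~ K z /\ ~ has_sqrt K (fun x => x - z)].

Lemma open_hull : open hull.
Proof.
rewrite openE => z [nKz ns]; apply/nbhs_modcP.
have [r r0 Hr] := has_sqrt_translate_local nKz; exists r => // y /Hr[nKy E].
by split => // /E.
Qed.

Lemma open_outside : open [set z | ~ K z /\ has_sqrt K (fun x => x - z)].
Proof.
rewrite openE => z [nKz ns]; apply/nbhs_modcP.
have [r r0 Hr] := has_sqrt_translate_local nKz; exists r => // y /Hr[nKy E].
by split => //; apply/E.
Qed.

Lemma compact_hullU : compact (hull `|` K).
Proof.
have [b Hb] := has_sqrt_translate_far.
apply: (@closed_bounded_compact R _ b).
  rewrite -openC (_ : ~` _ = [set z | ~ K z /\ has_sqrt K (fun x => x - z)]).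
    exact: open_outside.
  apply/seteqP; split => z /=.
    rewrite not_orP not_andP => -[[/contrapT //|/contrapT H] nK]; by split.
  by move=> [nK H] [[]|].
move=> z; case: (leP (modc z) b) => // /Hb[nK H] [[_ /(_ H)//]|/nK//].
Qed.

(** A relatively clopen part of the union that lies in [hull] is clopen in the plane and misses [K],
    hence is empty. So a nonempty clopen part meets [K], contains it by connectedness, and its
    complement lies in [hull]. *)
Lemma connected_hullU : K !=set0 -> connected K -> connected (hull `|` K).
Proof.
move=> K0 conK; have clK := compact_closed (@hausdorffC R) compactK.
have clU := compact_closed (@hausdorffC R) compact_hullU.
have noE (E : set C) : E `<=` hull -> (exists2 U, open U & E = (hull `|` K) `&` U) ->
    (exists2 F, closed F & E = (hull `|` K) `&` F) -> E = set0.
  move=> EG [U oU EU] [F cF EF].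
  have oE : open E.
    rewrite (_ : E = hull `&` U); first by apply: openI => //; exact: open_hull.
    apply/seteqP; split => z; first by move=> Ez; split; [exact: EG | rewrite EU in Ez; case: Ez].
    by move=> [Gz Uz]; rewrite EU; split => //; left.
  have cE : closed E by rewrite EF; exact: closedI.
  have [->//|/set0P E0] := eqVneq E set0.
  have := @connectedC R E E0 (ex_intro2 _ _ E oE (esym (setTI _)))
    (ex_intro2 _ _ E cE (esym (setTI _))).
  move=> ET; have [x Kx] := K0; exfalso.
  by have /EG[] : E x by rewrite ET.
move=> B [b Bb] [U oU BU] [F cF BF].
have [BK|BK] := pselect ((B `&` K) !=set0); last first.
  exfalso; have E0 : B = set0.
    apply: noE; [|by exists U | by exists F].
    move=> z Bz; have : (hull `|` K) z by rewrite BU in Bz; case: Bz.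
    by case=> // Kz; exfalso; apply: BK; exists z.
  by rewrite E0 in Bb.
have KB : K `<=` B.
  have -> : K = B `&` K; last by move=> z [].
  symmetry; apply: conK => //.
  - exists U => //; rewrite BU; apply/seteqP; split => z; first by move=> [[_ ?] ?].
    by move=> [? ?]; split => //; split => //; right.
  - exists F => //; rewrite BF; apply/seteqP; split => z; first by move=> [[_ ?] ?].
    by move=> [? ?]; split => //; split => //; right.
apply/seteqP; split; first by rewrite BU => z [].
have D0 : (hull `|` K) `&` ~` B = set0.
  apply: noE.
  - by move=> z [[//|/KB Bz] nB].
  - exists (~` F); first exact: closed_openC.
    by rewrite BF setCI setIUr setICr set0U.
  - exists (~` U); first exact: open_closedC.
    by rewrite BU setCI setIUr setICr set0U.
move=> z Az; apply: contrapT => nB.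
by have : ((hull `|` K) `&` ~` B) z by []; rewrite D0.
Qed.

End Hull.

(** * Normal families *)

Section Normality.
Variable R : realType.
Local Notation C := (R[i]^o).
Implicit Types (u v : nat -> C -> C) (f g : C -> C) (K : set C).

Lemma uniform_modcP K v g : {uniform K, v @ \oo --> g} <->
  forall e : R, 0 < e -> exists N : nat, forall n, (N <= n)%N ->
    forall z, K z -> modc (v n z - g z) < e.
Proof.
split.
- move=> H e e0.
  have : nbhs (g : {uniform` K -> C}) [set h | forall z, K z -> modc (h z - g z) < e].
    apply/uniform_nbhs; exists [set xy : C * C | ball xy.1 (e%:C : R[i]) xy.2].
    split; first by rewrite -entourage_ballE; exists e%:C => //=; rewrite ltcR.
    move=> h Hh z Kz; have := Hh z Kz; rewrite -ball_normE /= normE ltcR.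
    by rewrite modc_distrC.
  by move=> /H[N _ HN]; exists N => n Nn; exact: HN.
- move=> H P /uniform_nbhs[E [entE EP]].
  move: entE; rewrite -entourage_ballE => -[e /= e0 eE].
  have [r r0 er] := ltc_real_gt0 e0.
  have [N HN] := H _ r0; exists N => // n Nn; apply: EP => z Kz.
  apply: eE; rewrite /= -ball_normE /= er normE ltcR modc_distrC.
  exact: HN Nn z Kz.
Qed.

(** Differences of members of the sequence are entire, so the maximum principle applies to them,
    whereas a limit function on [K] would have to be extended. *)
Definition unif_cauchy K v := forall e : R, 0 < e -> exists N : nat,
  forall i j, (N <= i)%N -> (N <= j)%N -> forall z, K z -> modc (v i z - v j z) < e.

Definition unif_infty K v := forall M : R, exists N : nat,
  forall i, (N <= i)%N -> forall z, K z -> M < modc (v i z).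

(* Normality in a form which passes to unions of intersecting sets. *)
Definition precompact_on K (F : set (C -> C)) := forall u, (forall k, F (u k)) ->
  exists2 phi : nat -> nat, {homo phi : i j / (i < j)%N} &
    unif_cauchy K (u \o phi) \/ unif_infty K (u \o phi).

Lemma leq_homo_ltn (phi : nat -> nat) : {homo phi : i j / (i < j)%N} ->
  forall n, (n <= phi n)%N.
Proof.
move=> H; elim=> [//|n IH]; exact: leq_ltn_trans IH (H _ _ (ltnSn n)).
Qed.

Lemma unif_cauchy_sub K v (phi : nat -> nat) : {homo phi : i j / (i < j)%N} ->
  unif_cauchy K v -> unif_cauchy K (v \o phi).
Proof.
move=> Hp H e e0; have [N HN] := H e e0; exists N => i j Ni Nj z Kz.
by apply: HN => //; apply: leq_trans (leq_homo_ltn Hp _).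
Qed.

Lemma unif_infty_sub K v (phi : nat -> nat) : {homo phi : i j / (i < j)%N} ->
  unif_infty K v -> unif_infty K (v \o phi).
Proof.
move=> Hp H M; have [N HN] := H M; exists N => i Ni z Kz.
by apply: HN => //; apply: leq_trans (leq_homo_ltn Hp _).
Qed.

Lemma not_cauchy_and_infty K v z : K z -> unif_cauchy K v -> unif_infty K v -> False.
Proof.
move=> Kz Hc Hi; have [N HN] := Hc 1 ltr01.
have [N' HN'] := Hi (modc (v N z) + 1).
have H1 := HN (maxn N N') N (leq_maxl _ _) (leqnn _) z Kz.
have H2 := HN' (maxn N N') (leq_maxr _ _) z Kz.
have := modcD (v (maxn N N') z - v N z) (v N z); rewrite subrK.
lra.
Qed.

Lemma precompact_onS K K' F : K' `<=` K -> precompact_on K F -> precompact_on K' F.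
Proof.
move=> sub H u Fu; have [phi Hp [Hc|Hi]] := H u Fu; exists phi => //; [left|right].
- by move=> e e0; have [N HN] := Hc e e0; exists N => i j Ni Nj z /sub; exact: HN.
- by move=> M; have [N HN] := Hi M; exists N => i Ni z /sub; exact: HN.
Qed.

(** A subsequence for [K1] is refined to one for [K2]. The common point excludes a finite limit on
    one set with an infinite one on the other. *)
Lemma precompact_onU K1 K2 F z0 : K1 z0 -> K2 z0 ->
  precompact_on K1 F -> precompact_on K2 F -> precompact_on (K1 `|` K2) F.
Proof.
move=> K10 K20 H1 H2 u Fu; have [p1 Hp1 C1] := H1 u Fu.
have [p2 Hp2 C2] := H2 (u \o p1) (fun k => Fu _).
have K10' : (K1 `&` K2) z0 by [].
exists (p1 \o p2); first by move=> i j /Hp2 /Hp1.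
have S (v : nat -> C -> C) : (unif_cauchy K1 v -> unif_cauchy (K1 `&` K2) v) /\
    (unif_cauchy K2 v -> unif_cauchy (K1 `&` K2) v) /\
    (unif_infty K1 v -> unif_infty (K1 `&` K2) v) /\
    (unif_infty K2 v -> unif_infty (K1 `&` K2) v).
  split; last split; last split.
  - by move=> H e e0; have [N HN] := H e e0; exists N => i j Ni Nj z []; eauto.
  - by move=> H e e0; have [N HN] := H e e0; exists N => i j Ni Nj z []; eauto.
  - by move=> H M; have [N HN] := H M; exists N => i Ni z []; eauto.
  - by move=> H M; have [N HN] := H M; exists N => i Ni z []; eauto.
have [s1 [s2 [s3 s4]]] := S ((u \o p1) \o p2).
case: C1 => [C1|C1]; [have {}C1 := unif_cauchy_sub Hp2 C1|have {}C1 := unif_infty_sub Hp2 C1];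
  case: C2 => C2.
- left=> e e0; have [N HN] := C1 e e0; have [N' HN'] := C2 e e0.
  exists (maxn N N') => i j; rewrite !geq_max => /andP[i1 i2] /andP[j1 j2] z [Kz|Kz].
    exact: HN.
  exact: HN'.
- by exfalso; exact: (not_cauchy_and_infty K10' (s1 C1) (s4 C2)).
- by exfalso; exact: (not_cauchy_and_infty K10' (s2 C2) (s3 C1)).
- right=> M; have [N HN] := C1 M; have [N' HN'] := C2 M.
  exists (maxn N N') => i; rewrite !geq_max => /andP[i1 i2] z [Kz|Kz].
    exact: HN.
  exact: HN'.
Qed.

Lemma normal_precompact_on U K F : normal_family U F -> compact K -> K `<=` U ->
  precompact_on K F.
Proof.
move=> nF cK KU u Fu; have [phi Hp H] := nF u Fu; exists phi => //.
case: H => [[g Hg]|Hi]; [left|right].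
- move=> e e0; have e2 : 0 < e / 2 by rewrite divr_gt0.
  have [N HN] := (uniform_modcP _ _ _).1 (Hg K cK KU) _ e2.
  exists N => i j Ni Nj z Kz; apply: le_lt_trans (modc_triangle (g z) _ _) _.
  rewrite [e]splitr; apply: ltrD; first exact: HN.
  by rewrite modc_distrC; exact: HN.
- move=> M; have [N _ HN] := Hi K cK KU M; exists N => i Ni z Kz.
  by have := HN i Ni z Kz; rewrite normE ltcR.
Qed.

Lemma cauchy_modc_cvg (w : nat -> C) :
  (forall e : R, 0 < e -> exists N : nat, forall i j, (N <= i)%N -> (N <= j)%N ->
     modc (w i - w j) < e) ->
  exists l : C, forall e : R, 0 < e -> exists N : nat, forall i, (N <= i)%N ->
     modc (w i - l) < e.
Proof.
move=> H.
have real (p : C -> R) : (forall x y, `|p x - p y| <= modc (x - y)) ->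
    exists l : R, forall e : R, 0 < e -> exists N : nat, forall i, (N <= i)%N ->
      `|p (w i) - l| < e.
  move=> Hp.
  have cw : cauchy ((fun n => p (w n)) @ \oo).
    apply: cauchy_exP => e e0; have [N HN] := H e e0.
    exists (p (w N)); exists N => // n /= Nn.
    rewrite -ball_normE /=; exact: le_lt_trans (Hp _ _) (HN _ _ (leqnn N) Nn).
  have /cvg_ex[l /= Hl] : cvg ((fun n => p (w n)) @ \oo) by apply/cauchy_cvgP.
  exists l => e e0; have [N _ HN] := (cvgrPdist_lt _ _).1 Hl e e0.
  by exists N => i Ni; rewrite distrC; exact: HN.
have [|a Ha] := real (@Re R); first by move=> x y; rewrite -Re_opp -Re_add normr_Re_le.
have [|b Hb] := real (@Im R); first by move=> x y; rewrite -Im_opp -Im_add normr_Im_le.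
exists (a +i* b)%C => e e0; have e2 : 0 < e / 2 by rewrite divr_gt0.
have [N HN] := Ha _ e2; have [N' HN'] := Hb _ e2.
exists (maxn N N') => i; rewrite geq_max => /andP[i1 i2].
apply: le_lt_trans (modc_le_ReIm _) _.
rewrite !(Re_add, Re_opp, Im_add, Im_opp) [e]splitr.
by apply: ltrD; [exact: HN | exact: HN'].
Qed.

Lemma precompact_on_normal U F : precompact_on U F -> normal_family U F.
Proof.
move=> H u Fu; have [phi Hp [Hc|Hi]] := H u Fu; exists phi => //; [left|right]; last first.
  move=> K cK KU M; have [N HN] := Hi M; exists N => // n /= Nn z /KU Uz.
  by rewrite normE ltcR; exact: HN.
have /choice[g Hg] : forall z, exists l : C, U z -> forall e : R, 0 < e ->
    exists N : nat, forall i, (N <= i)%N -> modc ((u \o phi) i z - l) < e.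
  move=> z; have [Uz|nU] := pselect (U z); last by exists 0.
  have [|l Hl] := @cauchy_modc_cvg (fun i => (u \o phi) i z); last by exists l.
  by move=> e e0; have [N HN] := Hc e e0; exists N => i j Ni Nj; exact: HN.
exists g => K cK KU; apply/uniform_modcP => e e0.
have e2 : 0 < e / 2 by rewrite divr_gt0.
have [N HN] := Hc _ e2; exists N => n Nn z /KU Uz.
have [N' HN'] := Hg z Uz _ e2.
apply: le_lt_trans (modc_triangle ((u \o phi) (maxn N N') z) _ _) _.
rewrite [e]splitr; apply: ltrD.
  by apply: HN => //; exact: leq_maxl.
by apply: HN'; exact: leq_maxr.
Qed.

(* Both [h] and [1 / (h - a)] satisfy the maximum principle. *)
Lemma precompact_on_hull (a : C) (G K : set C) F :
  (forall h, F h -> entire h /\ forall z, h z != a) -> open G -> compact (G `|` K) ->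
  precompact_on K F -> precompact_on (G `|` K) F.
Proof.
move=> HF oG cK H u Fu; have [phi Hp [Hc|Hi]] := H u Fu; exists phi => //; [left|right].
- move=> e e0; have e2 : 0 < e / 2 by rewrite divr_gt0.
  have [N HN] := Hc _ e2; exists N => i j Ni Nj z.
  have [ei _] := HF _ (Fu (phi i)); have [ej _] := HF _ (Fu (phi j)).
  have small w : K w -> modc ((u \o phi) i w - (u \o phi) j w) <= e / 2.
    by move=> Kw; apply: ltW; exact: HN.
  have e2e : e / 2 < e by rewrite ltr_pdivrMr // ltr_pMr // ltr1n.
  move=> GKz; apply: le_lt_trans e2e; case: GKz => [Gz|]; last exact: small.
  exact: (maximum_principle (entireB ei ej) oG cK small Gz).
(* One [modc a] is lost in passing from [u] to [u - a] on [K] and another in passing back at [z];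
   the [1] makes [M'] positive and the final inequality strict. *)
- move=> M; pose M' := `|M| + modc a + 1.
  have M0 : 0 < M' by rewrite ltr_wpDl // addr_ge0 // modc_ge0.
  have [N HN] := Hi (M' + modc a); exists N => i Ni z.
  have [ei ea] := HF _ (Fu (phi i)).
  have nz w : u (phi i) w - a != 0 by rewrite subr_eq0.
  have eB : entire (fun w => u (phi i) w - a) := entireB ei (@entire_cst R a).
  have eV := entireV eB nz.
  have big w : K w -> M' <= modc (u (phi i) w - a).
    move=> Kw; have := HN i Ni w Kw; have := modcD (u (phi i) w - a) a.
    by rewrite subrK /=; lra.
  have small w : K w -> modc ((u (phi i) w - a)^-1) <= M'^-1.
    move=> Kw; have B := big w Kw.
    by rewrite Normc.normcV lef_pV2 // posrE (lt_le_trans M0).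
  have Hz : (G `|` K) z -> M' <= modc (u (phi i) z - a).
    case=> [Gz|]; last exact: big.
    have := maximum_principle eV oG cK small Gz.
    by rewrite Normc.normcV lef_pV2 // posrE modc_gt0.
  move=> /Hz B; have := modcB (u (phi i) z) a; have := ler_norm M.
  by rewrite /M' /= in B *; lra.
Qed.

End Normality.

(** * Connectedness up to closure and chains of squares *)

Section ConnectedSets.
Variable R : realType.
Local Notation C := (R[i]^o).

Lemma connected_between (A B : set C) : connected A -> A `<=` B -> B `<=` closure A ->
  connected B.
Proof.
move=> cA AB Bcl X [x Xx] [U oU XU] [F cF XF].
have [Bx Ux] : (B `&` U) x by rewrite -XU.
have [y [Ay Uy]] := Bcl x Bx U (open_nbhs_nbhs (conj oU Ux)).
have AU : A `&` U = A.
  apply: cA; first by exists y.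
  - by exists U.
  - exists F => //; apply/seteqP; split => z [Az].
    + by move=> Uz; split => //; have [] : (B `&` F) z by rewrite -XF XU; split => //; exact: AB.
    + by move=> Fz; split => //; have [] : (B `&` U) z by rewrite -XU XF; split => //; exact: AB.
have AF : A `<=` F.
  move=> z Az; have [_ Uz] : (A `&` U) z by rewrite AU.
  by have [] : (B `&` F) z by rewrite -XF XU; split => //; exact: AB.
rewrite XF; apply/seteqP; split => z; first by case.
by move=> Bz; split => //; apply: cF; exact: closure_subset AF _ (Bcl z Bz).
Qed.

(** The points that such a set [p] joins to [x] form a clopen part of [E]. The property [good] is
    abstract so that normality can be carried along the chain. *)
Lemma connected_chain (E : set C) (good : set C -> Prop) : connected E ->
  (forall x, E x -> exists r : R, [/\ 0 < r, box x r `<=` E & good (box x r)]) ->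
  (forall p1 p2 z, p1 z -> p2 z -> good p1 -> good p2 -> good (p1 `|` p2)) ->
  forall x y, E x -> E y ->
    exists p : set C, [/\ compact p, connected p, p `<=` E, p x /\ p y & good p].
Proof.
move=> cE Hbox HU x y Ex Ey.
pose P := [set y | E y /\
  exists p : set C, [/\ compact p, connected p, p `<=` E, p x /\ p y & good p]].
have bcenter (z : C) (r : R) : 0 < r -> box z r z.
  by move=> r0; apply: modc_box; rewrite subrr Normc.normc0 ltW.
have key z r w : 0 < r -> box z r `<=` E -> good (box z r) ->
    box z r w -> P w -> box z r `<=` P.
  move=> r0 bE gb bw [_ [p [cp conp pE [px pw] gp]]] t bt.
  split; first exact: bE.
  exists (p `|` box z r); split.
  - by apply: compactU => //; exact: box_compact.
  - by apply: connectedU => //; [exists w | apply: connected_box; exact: ltW].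
  - by move=> s [/pE|/bE].
  - by split; [left | right].
  - exact: (HU _ _ w).
have nb (z : C) (r : R) (Q : set C) : 0 < r -> box z r `<=` Q -> nbhs z Q.
  move=> r0 bQ; apply/nbhs_modcP; exists r => // t tr; apply: bQ.
  by apply: modc_box; exact: ltW.
suff PE : P = E by have [] : P y by rewrite PE.
apply: cE.
- exists x; split => //; have [r [r0 bE gb]] := Hbox x Ex.
  exists (box x r); split => //; first exact: box_compact.
  + by apply: connected_box; exact: ltW.
  + by split; exact: bcenter.
- exists P; last by apply/seteqP; split => z; [move=> Pz; split => //; case: Pz | case].
  rewrite openE => z Pz; have [r [r0 bE gb]] := Hbox z Pz.1.
  by apply: (nb _ r) => //; apply: (key _ _ z) => //; exact: bcenter.
(* By [key] a square that meets [P] lies in [P], so the square around a point of [E] outside [P]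
   avoids [P]. *)
- exists (~` (E `\` P)); last first.
    apply/seteqP; split => z; first by move=> Pz; split; [case: Pz | case].
    by move=> [Ez nEP]; apply: contrapT => nP; apply: nEP.
  apply: open_closedC; rewrite openE => z [Ez nPz].
  have [r [r0 bE gb]] := Hbox z Ez.
  apply: (nb _ r) => // t bt; split; first exact: bE.
  by move=> Pt; apply: nPz; apply: (key z r t) => //; exact: bcenter.
Qed.

Lemma within_continuous_comp (p : set C) (S L : C -> C) : continuous S ->
  {within S @` p, continuous L} -> {within p, continuous (L \o S)}.
Proof.
move=> cS /(@subspace_continuousP C (S @` p) C) cL.
apply/(@subspace_continuousP C p C) => y py A nA.
have H : nbhs y [set s | (S @` p) (S s) -> A (L (S s))] :=
  cS y _ (cL (S y) (ex_intro2 _ _ y py erefl) A nA).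
have : nbhs y [set s | p s -> A (L (S s))].
  by apply: filterS H => s Hs ps; apply: Hs; exists s.
by [].
Qed.

End ConnectedSets.

(** * Components of the Fatou set *)

Section Fatou.
Variable R : realType.
Local Notation C := (R[i]^o).
Variable f : C -> C.

Lemma open_fatou_set : open (fatou_set f).
Proof.
rewrite openE => z [U [oU Uz] nU]; apply: filterS (open_nbhs_nbhs (conj oU Uz)) => y Uy.
by exists U.
Qed.

Lemma fatou_component_max D x (B : set C) : fatou_component f D -> D x -> B x ->
  B `<=` fatou_set f -> connected B -> B `<=` D.
Proof.
move=> [z Fz ->] Dx Bx BF cB.
by rewrite (same_connected_component Dx); exact: connected_component_max.
Qed.

Lemma fatou_component_sub D : fatou_component f D -> D `<=` fatou_set f.
Proof. by move=> [z Fz ->]; exact: connected_component_sub. Qed.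

Lemma fatou_component_connected D : fatou_component f D -> connected D.
Proof. by move=> [z Fz ->]; exact: component_connected. Qed.

Lemma fatou_component_neq0 D : fatou_component f D -> D !=set0.
Proof. by move=> [z Fz ->]; exists z; exact: connected_component_refl. Qed.

Lemma open_fatou_component D : fatou_component f D -> open D.
Proof.
move=> HD; rewrite openE => x Dx.
have /nbhs_modcP[r r0 Hr] : nbhs x (fatou_set f).
  apply: open_nbhs_nbhs; split; first exact: open_fatou_set.
  exact: fatou_component_sub HD x Dx.
apply/nbhs_modcP; exists r => // y yr.
apply: (@fatou_component_max D x [set w | modc (w - x) < r]) => //.
- by rewrite /mkset subrr Normc.normc0.
- exact: connected_ball_modc.
Qed.

End Fatou.

Theorem mainTheorem2 (R : realType) (f : R[i]^o -> R[i]^o) (D : set R[i]^o)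
    (a : R[i]^o) (Hf : transcendental_entire f)
    (HD : completely_invariant_domain f D)
    (Ha : forall z : R[i]^o, f z <> a) :
  D a.
Proof.
case: Hf => ef nonpoly; case: HD => cD fD; apply: contrapT => nDa.
have openD := open_fatou_component cD.
have fa0 z : f z - a != 0 by rewrite subr_eq0; apply/eqP.
have [q eq qf] := exists_entire_sqrt (entireB ef (@entire_cst R a)) fa0.
have nonconst : ~ (forall z, q z = q 0).
  move=> qc; apply: nonpoly; exists ((q 0) ^+ 2 + a)%:P => z.
  by rewrite hornerC -(qc z) qf subrK.
pose S (w : R[i]^o) : R[i]^o := w ^+ 2 + a.
have cS : continuous S.
  exact: (@entire_continuous R _ (entireD (entire_sqr (@entire_id R)) (@entire_cst R a))).
have Sq z : S (q z) = f z by rewrite /S qf subrK.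
pose E := [set w | D (S w)].
have openE : open E by apply: open_comp => // w _; exact: cS.
have Dq z : E (q z) -> D z by rewrite /E /mkset Sq -[in X in _ -> X]fD.
have qD z : D z -> E (q z) by rewrite /E /mkset Sq -{1}fD.
have conE : connected E.
  apply: (@connected_between R (q @` D)).
  - apply: connected_continuous_connected; first exact: fatou_component_connected cD.
    by apply: continuous_subspaceT; exact: entire_continuous.
  - by move=> _ [z Dz <-]; exact: qD.
  - move=> w Ew V nV.
    have /nbhs_modcP[r r0 Hr] : nbhs w (E `&` V).
      by apply: filterI => //; exact: open_nbhs_nbhs.
    have [z qz] := entire_dense w eq nonconst r0.
    have [Eqz Vqz] := Hr _ qz.
    by exists (q z); split => //; exists z => //; exact: Dq.
have [z0 Dz0] := fatou_component_neq0 cD.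
pose w := q z0; have Ew : E w by exact: qD.
have ENw : E (- w) by rewrite /E /mkset /S sqrrN.
have E0 v : E v -> v != 0.
  by move=> Ev; apply/eqP => v0; apply: nDa; move: Ev; rewrite v0 /E /mkset /S expr0n add0r.
(* Normality is required on the image under [S], so that the chain built in [E] delivers it on [K]
   at once. *)
pose good p := precompact_on (S @` p) (iterates f).
have [p [cp conp pE [pw pNw] gp]] :
    exists p, [/\ compact p, connected p, p `<=` E, p w /\ p (- w) & good p].
  apply: connected_chain => //.
  - move=> x Ex; have [U [oU Ux] nU] := fatou_component_sub cD Ex.
    have /nbhs_modcP[r r0 Hr] : nbhs x (E `&` (S @^-1` U)).
      apply: filterI; first exact: open_nbhs_nbhs.
      by apply: (cS x); exact: open_nbhs_nbhs.
    (* A square of half-side [r / 4] lies within modulus [r / 2] of its centre. *)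
    have bsub : box x (r / 4) `<=` E `&` (S @^-1` U).
      by move=> y /box_modc yb; apply: Hr; apply: le_lt_trans yb _; lra.
    exists (r / 4); split; first by rewrite divr_gt0.
      by move=> y /bsub[].
    apply: (normal_precompact_on nU).
      apply: continuous_compact; last exact: box_compact.
      exact: continuous_subspaceT.
    by move=> _ [y /bsub[_ SU] <-].
  - move=> p1 p2 z p1z p2z g1 g2; rewrite /good image_setU.
    by apply: (precompact_onU (z0 := S z)) => //; exists z.
pose K := S @` p.
have cK : compact K by apply: continuous_compact; [exact: continuous_subspaceT | exact: cp].
have conK : connected K.
  by apply: connected_continuous_connected; [exact: conp | exact: continuous_subspaceT].
have KD : K `<=` D by move=> _ [v /pE Ev <-].
have K0 : K !=set0 by exists (S w); exists w.
have [[L cL LK]|nsq] := pselect (has_sqrt K (fun x => x - a)).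
  have cLS := within_continuous_comp cS cL.
  have cid : {within p, continuous (id : R[i]^o -> R[i]^o)}.
    by apply: continuous_subspaceT => v; exact: cvg_id.
  have LS v : p v -> (L \o S) v ^+ 2 = v ^+ 2.
    by move=> pv; rewrite /= LK; [rewrite /S addrK | exists v].
  have nz v : p v -> v != 0 by move=> /pE; exact: E0.
  have := sqrt_ratio_cst conp cLS cid LS nz pw pNw.
  (* As [S (- w) = S w], the ratio equals its own opposite, which forces [L (S w) = 0], although the
     square of [L (S w)] is [w ^+ 2] and [w] is nonzero. *)
  rewrite /= {2}/S sqrrN -/(S w) invrN mulrN => /eqP.
  rewrite -addr_eq0 -mulr2n mulrn_eq0 /= mulf_eq0 invr_eq0 (negbTE (nz _ pw)) orbF.
  move=> /eqP L0; have := LS w pw; rewrite /= L0 expr0n => /eqP.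
  by rewrite eq_sym expf_eq0 (negbTE (nz _ pw)).
have Ga : hull K a by split => // /KD.
have HF h : iterates f h -> entire h /\ forall z, h z != a.
  move=> [n n1 ->]; split; first exact: (@entire_iter R f n ef).
  by case: n n1 => [|n _ z]; [rewrite ltnn | apply/eqP; exact: Ha].
have preG := precompact_on_hull HF (open_hull cK) (compact_hullU cK) gp.
have nG : normal_family (hull K) (iterates f).
  by apply: precompact_on_normal; apply: precompact_onS preG; left.
have hullF : hull K `|` K `<=` fatou_set f.
  move=> z [Gz|/KD]; last exact: fatou_component_sub.
  by exists (hull K) => [|//]; split; [exact: open_hull | exact: Gz].
have [x0 Kx0] := K0.
apply: nDa; apply: (fatou_component_max cD (KD _ Kx0) (or_intror Kx0) hullF).
  exact: connected_hullU.
by left.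
Qed.
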